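(* Let $H$ be a connected finite dimensional hereditary algebra over a field, with $n$ isomorphism classes of simple modules, and let $\mathcal E=(E_1,\dots,E_n)$ be a complete exceptional sequence in $\operatorname{mod}H$. Then the Hom-Ext quiver $\mathcal Q_{\mathcal E}$ of $\mathcal E$ is connected.
   Context: $\operatorname{mod}H$ is the category of finitely generated $H$-modules. An algebra is connected if it is not a product of two nonzero algebras. An indecomposable $H$-module $E$ is exceptional if $\operatorname{Ext}^1(E,E)=0$. A sequence $(E_1,\dots,E_r)$ of exceptional modules is an exceptional sequence if $\operatorname{Hom}(E_j,E_i)=0=\operatorname{Ext}^1(E_j,E_i)$ for $j>i$; it is complete if $r=n$. The Hom-Ext quiver $\mathcal Q_{\mathcal E}$ of $\mathcal E=(E_1,\dots,E_r)$ has vertex set $\{E_1,\dots,E_r\}$, and there is an arrow $E_i\to E_j$ if $\operatorname{Hom}(E_i,E_j)\ne0$ or $\operatorname{Ext}^1(E_j,E_i)\ne 0$. Connected means that the underlying undirected graph is connected. *)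

(* Defs.v *)
From HB Require Import structures.
From mathcomp Require Import all_boot all_order all_algebra all_field.
From Stdlib Require Import Relation_Definitions Relation_Operators.

Set Implicit Arguments.
Unset Strict Implicit.
Unset Printing Implicit Defensive.

Import GRing.Theory.
Local Open Scope ring_scope.

Section Modules.
Variable R : nzRingType.
Implicit Types M N : lmodType R.

Definition zero_module M : Prop := forall x : M, x = 0.

Definition module_iso M N : Prop := exists f : {linear M -> N}, bijective f.

Definition finitely_generated M : Prop :=
  exists (m : nat) (g : 'I_m -> M),
    forall x : M, exists c : 'I_m -> R, x = \sum_(i < m) c i *: g i.

Definition is_submodule M (P : M -> Prop) : Prop :=
  P 0 /\ (forall (a : R) (x y : M), P x -> P y -> P (a *: x + y)).

Definition simple_module M : Prop :=
  ~ zero_module M /\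
  (forall P : M -> Prop, is_submodule P ->
     (forall x, P x -> x = 0) \/ (forall x, P x)).

Definition indecomposable M : Prop :=
  ~ zero_module M /\
  (forall A B : lmodType R, module_iso M (A * B)%type ->
     zero_module A \/ zero_module B).

Definition projective (P : lmodType R) : Prop :=
  forall (A B : lmodType R) (g : {linear A -> B}) (f : {linear P -> B}),
    (forall b, exists a, g a = b) ->
    exists h : {linear P -> A}, forall x, g (h x) = f x.

(* A left ideal is given as a module embedded in the regular module. *)
Definition hereditary : Prop :=
  forall (I : lmodType R) (i : {linear I -> R^o}), injective i -> projective I.

Definition number_of_simples (n : nat) : Prop :=
  exists S : 'I_n -> lmodType R,
    [/\ forall i, simple_module (S i),
        forall i j, module_iso (S i) (S j) -> i = j &
        forall M, simple_module M -> exists i, module_iso M (S i)].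

Definition Hom_zero M N : Prop := forall (f : {linear M -> N}) x, f x = 0.

(* Short exact sequences 0 -> N -> E -> M -> 0, whose equivalence classes are
   the elements of Ext^1(M, N). *)
Record extension M N := Extension {
  ext_mid : lmodType R;
  ext_inj : {linear N -> ext_mid};
  ext_proj : {linear ext_mid -> M};
  ext_inj_injective : injective ext_inj;
  ext_exact : forall x, ext_proj x = 0 <-> exists y, ext_inj y = x;
  ext_proj_surjective : forall z, exists x, ext_proj x = z }.

Definition ext_equiv M N (X Y : extension M N) : Prop :=
  exists f : {linear ext_mid X -> ext_mid Y},
    [/\ bijective f,
        forall y, f (ext_inj X y) = ext_inj Y y &
        forall x, ext_proj Y (f x) = ext_proj X x].

Section SplitExtension.
Variables M N : lmodType R.

Definition split_inj (y : N) : (N * M)%type := (y, 0).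

Fact split_inj_linear : linear split_inj.
Proof.
by move=> a x y; congr pair; rewrite /= scaler0 addr0.
Qed.

HB.instance Definition _ :=
  GRing.isLinear.Build R N (N * M)%type _ split_inj split_inj_linear.

Definition split_proj (x : (N * M)%type) : M := x.2.

Fact split_proj_linear : linear split_proj.
Proof. by []. Qed.

HB.instance Definition _ :=
  GRing.isLinear.Build R (N * M)%type M _ split_proj split_proj_linear.

Fact split_inj_injective : injective split_inj.
Proof. by move=> x y []. Qed.

Fact split_exact (x : (N * M)%type) :
  split_proj x = 0 <-> exists y, split_inj y = x.
Proof.
case: x => y z; split=> [/= z0|[y' [_ <-]]] //.
by exists y; rewrite -[z]/(split_proj (y, z)) z0.
Qed.

Fact split_proj_surjective z : exists x, split_proj x = z.
Proof. by exists (0, z). Qed.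

Definition split_extension : extension M N :=
  Extension split_inj_injective split_exact split_proj_surjective.
End SplitExtension.

(* The zero of Ext^1(M, N) is the class of the split extension. *)
Definition Ext1_zero M N : Prop :=
  forall X : extension M N, ext_equiv X (split_extension M N).

Definition exceptional M : Prop :=
  [/\ finitely_generated M, indecomposable M & Ext1_zero M M].

Definition exceptional_sequence (r : nat) (E : 'I_r -> lmodType R) : Prop :=
  (forall i, exceptional (E i)) /\
  (forall i j : 'I_r, (i < j)%N ->
     Hom_zero (E j) (E i) /\ Ext1_zero (E j) (E i)).

(* The vertex E_i is represented by its index i; distinct indices give
   non-isomorphic terms of an exceptional sequence. *)
Definition hom_ext_quiver (r : nat) (E : 'I_r -> lmodType R) : relation 'I_r :=
  fun i j => ~ Hom_zero (E i) (E j) \/ ~ Ext1_zero (E j) (E i).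

End Modules.

Definition quiver_connected (V : Type) (arrow : relation V) : Prop :=
  forall x y : V, clos_refl_sym_trans V arrow x y.

(* The factors A and B are nonzero because 1 != 0 in every falgType. *)
Definition connected_algebra (k : fieldType) (H : falgType k) : Prop :=
  ~ exists (A B : falgType k) (f : {lrmorphism H -> (A * B)%type}),
      bijective f.

(* Main.v *)
From HB Require Import structures.
Require Import Defs.
From mathcomp Require Import all_boot all_order all_algebra all_field.
From mathcomp Require Import boolp.
From Stdlib Require Import Relation_Operators.

(* Idea.  Suppose the quiver splits into two families [E_s] ([s] in [L]) and
   [E_t] ([t] not in [L]), so that Hom and Ext^1 vanish between them in both
   directions.
   Additive functions on finite-dimensional modules are determined by their
   values on the [n] simple modules, so the [n] Euler functions
   <E_s, -> = dim Hom(E_s, -) - dim Ext^1(E_s, -) and the dimension are linearly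
   dependent.  The matrix <E_s, E_t> is triangular with nonzero diagonal, hence
   the dimension is a combination of the <E_s, ->, and a module with no Hom and
   no Ext^1 from any [E_s] is zero.
   The regular module has a reflection [f1 : H -> Z1] in the right perpendicular
   category of the first family, and [f2 : H -> Z2] in that of the second one.
   The kernel and the cokernel of [(f1, f2) : H -> Z1 * Z2] are perpendicular to
   all [E_s], so this map is bijective.  By the universal property of the
   reflections there are no nonzero maps between [Z1] and [Z2], so the
   decomposition is given by a central idempotent, which is 0 or 1.  Then [H]
   itself is perpendicular to one of the families; for an [E_s] this makes [E_s]
   projective, hence contained in a free module, hence zero. *)

Set Implicit Arguments.
Unset Strict Implicit.
Unset Printing Implicit Defensive.

Import GRing.Theory VectorInternalTheory.
Local Open Scope ring_scope.

(** * Submodules, quotients and extensions *)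

Section SubQuotient.
Variables (R : nzRingType) (M : lmodType R) (P : M -> Prop).

Section Submodule.
Hypothesis subP : is_submodule P.

Let p : {pred M} := fun x => `[< P x >].

Fact submod_pred_closed : subsemimod_closed p.
Proof.
case: subP => P0 Plin; split; first split; rewrite ?inE /in_mem /=.
- exact/asboolP.
- by move=> x y /asboolP Px /asboolP Py; apply/asboolP; rewrite -[x]scale1r; apply: Plin.
- by move=> a x /asboolP Px; apply/asboolP; rewrite -[a *: x]addr0; apply: Plin.
Qed.

(* The proof argument lets the module structure be inferred from the type. *)
Definition submod_type (_ : is_submodule P) : Type := {x : M | p x}.
Notation S := (submod_type subP).
HB.instance Definition _ := SubChoice.on S.
HB.instance Definition _ :=
  GRing.SubChoice_isSubLmodule.Build R M p S submod_pred_closed.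

Lemma submodule_exists :
  exists (T : lmodType R) (i : {linear T -> M}),
    injective i /\ forall x, P x <-> exists s, i s = x.
Proof.
exists S, val; split=> [|x]; first exact: val_inj.
split=> [Px|[s <-]]; last exact/asboolP/(valP s).
have px : p x by exact/asboolP.
by exists (exist _ x px).
Qed.
End Submodule.

Section Quotient.
Hypothesis subP : is_submodule P.

Lemma submodD x y : P x -> P y -> P (x + y).
Proof. by case: subP => _ Pl Px Py; rewrite -[x]scale1r; apply: Pl. Qed.
Lemma submodZ a x : P x -> P (a *: x).
Proof. by case: subP => P0 Pl Px; rewrite -[_ *: _]addr0; apply: Pl. Qed.
Lemma submodB x y : P x -> P y -> P (x - y).
Proof. by move=> Px Py; apply: submodD => //; rewrite -scaleN1r; apply: submodZ. Qed.

(** Two elements of one coset define the same predicate, so [choose] gives a canonical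
    representative, and the quotient can be the subtype of fixed points of [rep]. *)
Let rep (x : M) : M := choose (fun y => `[< P (x - y) >]) x.

Lemma coset_repP x : P (x - rep x).
Proof.
suff /asboolP : `[< P (x - rep x) >] by [].
apply: (@chooseP _ (fun y => `[< P (x - y) >])).
by apply/asboolP; rewrite subrr; case: subP.
Qed.

Lemma coset_rep_eq x y : rep x = rep y <-> P (x - y).
Proof.
split=> [e|Pxy].
  have := submodB (coset_repP x) (coset_repP y).
  by rewrite e opprB addrA subrK.
rewrite /rep (@eq_choose _ _ (fun z => `[< P (y - z) >])) => [|z].
  apply: choose_id; apply/asboolP; last by rewrite subrr; case: subP.
  by rewrite -opprB -sub0r; apply: submodB => //; case: subP.
apply/asboolP/asboolP => Pz.
  by have := submodB Pz Pxy; rewrite opprB addrC addrA subrK.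
by have := submodD Pxy Pz; rewrite addrA subrK.
Qed.

Definition quot_type (_ : is_submodule P) : Type := {x : M | rep x == x}.
Notation Q := (quot_type subP).
HB.instance Definition _ := SubChoice.on Q.

Fact quot_proj_subproof x : rep (rep x) == rep x.
Proof.
apply/eqP/coset_rep_eq; rewrite -opprB -sub0r.
by apply: submodB; [case: subP | exact: coset_repP].
Qed.

Definition quot_proj (x : M) : Q := exist _ (rep x) (quot_proj_subproof x).

Lemma quot_proj_eq x y : quot_proj x = quot_proj y <-> P (x - y).
Proof.
rewrite -coset_rep_eq; split=> [[] //|e].
by apply: val_inj.
Qed.

Lemma quot_projK (u : Q) : quot_proj (val u) = u.
Proof. by apply: val_inj => /=; apply/eqP; exact: valP u. Qed.

Let qadd (u v : Q) := quot_proj (val u + val v).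
Let qopp (u : Q) := quot_proj (- val u).
Let qscale a (u : Q) := quot_proj (a *: val u).

Let qaddE x y : qadd (quot_proj x) (quot_proj y) = quot_proj (x + y).
Proof.
apply/quot_proj_eq; rewrite opprD addrACA -opprB -[X in _ + X]opprB -opprD -sub0r.
by apply: submodB; [case: subP | apply: submodD; exact: coset_repP].
Qed.

Let qoppE x : qopp (quot_proj x) = quot_proj (- x).
Proof.
by apply/quot_proj_eq; rewrite opprK addrC; exact: coset_repP.
Qed.

Let qscaleE a x : qscale a (quot_proj x) = quot_proj (a *: x).
Proof.
apply/quot_proj_eq; rewrite -scalerBr; apply: submodZ; rewrite -opprB -sub0r.
by apply: submodB; [case: subP | exact: coset_repP].
Qed.

Fact quot_addA : associative qadd.
Proof.
move=> u v w; rewrite -(quot_projK u) -(quot_projK v) -(quot_projK w).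
by rewrite !qaddE addrA.
Qed.
Fact quot_addC : commutative qadd.
Proof. by move=> u v; rewrite /qadd addrC. Qed.
Fact quot_add0 : left_id (quot_proj 0) qadd.
Proof. by move=> u; rewrite -(quot_projK u) qaddE add0r. Qed.
Fact quot_addN : left_inverse (quot_proj 0) qopp qadd.
Proof. by move=> u; rewrite -(quot_projK u) qoppE qaddE addNr. Qed.
HB.instance Definition _ :=
  GRing.isZmodule.Build Q quot_addA quot_addC quot_add0 quot_addN.

Fact quot_scaleA a b u : qscale a (qscale b u) = qscale (a * b) u.
Proof. by rewrite -(quot_projK u) !qscaleE scalerA. Qed.
Fact quot_scale1 : left_id 1 qscale.
Proof. by move=> u; rewrite -(quot_projK u) qscaleE scale1r. Qed.
Fact quot_scaleDr : right_distributive qscale +%R.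
Proof.
have qD x y : quot_proj x + quot_proj y = quot_proj (x + y) := qaddE x y.
move=> a u v; rewrite -(quot_projK u) -(quot_projK v).
by rewrite qD !qscaleE qD scalerDr.
Qed.
Fact quot_scaleDl u : {morph qscale^~ u : a b / a + b}.
Proof.
move=> a b; rewrite -(quot_projK u) !qscaleE scalerDl; symmetry; exact: qaddE.
Qed.
HB.instance Definition _ := GRing.Zmodule_isLmodule.Build R Q
  quot_scaleA quot_scale1 quot_scaleDr quot_scaleDl.

Fact quot_proj_linear : linear quot_proj.
Proof.
by move=> a x y; rewrite -qaddE -qscaleE.
Qed.
HB.instance Definition _ :=
  GRing.isLinear.Build R M Q _ quot_proj quot_proj_linear.

Lemma quotient_exists :
  exists (T : lmodType R) (q : {linear M -> T}),
    (forall y, exists x, q x = y) /\ forall x, q x = 0 <-> P x.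
Proof.
exists Q, quot_proj; split=> [y|x]; first by exists (val y); exact: quot_projK.
by rewrite -[X in _ = X]/(quot_proj 0) quot_proj_eq subr0.
Qed.
End Quotient.
End SubQuotient.

(** * Factorisations, short exact sequences, pushouts, pullbacks and splittings *)

Section Maps.
Variable R : nzRingType.
Implicit Types A B C D I K M N S T X Y Z : lmodType R.

Definition lin_of A B (f : A -> B) (lf : linear f) : {linear A -> B} :=
  HB.pack f (GRing.isLinear.Build R A B _ f lf).

Lemma factor_surj A B C (q : {linear A -> B}) (f : {linear A -> C}) :
  (forall y, exists x, q x = y) -> (forall x, q x = 0 -> f x = 0) ->
  exists g : {linear B -> C}, forall x, g (q x) = f x.
Proof.
move=> q_surj qf0; have [r rK] := choice q_surj.
have fq x y : q x = q y -> f x = f y.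
  move=> e; apply/eqP; rewrite -subr_eq0 -linearB; apply/eqP/qf0.
  by rewrite linearB e subrr.
have lg : linear (f \o r).
  by move=> a x y /=; rewrite -linearP; apply: fq; rewrite linearP !rK.
by exists (lin_of lg) => x /=; apply: fq; rewrite rK.
Qed.

Lemma factor_inj S M A (i : {linear S -> M}) (f : {linear A -> M}) :
  injective i -> (forall x, exists s, i s = f x) ->
  exists g : {linear A -> S}, forall x, i (g x) = f x.
Proof.
move=> i_inj /choice[g gK].
have lg : linear g by move=> a x y; apply: i_inj; rewrite linearP !gK linearP.
by exists (lin_of lg).
Qed.

Definition ses A B C (i : {linear A -> B}) (p : {linear B -> C}) : Prop :=
  [/\ injective i, forall x, p x = 0 <-> exists y, i y = x
    & forall z, exists x, p x = z].

Lemma ses_comp0 A B C (i : {linear A -> B}) (p : {linear B -> C}) x :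
  ses i p -> p (i x) = 0.
Proof. by case=> _ ex _; apply/ex; exists x. Qed.

Lemma linear_submod_ker A B (f : {linear A -> B}) :
  is_submodule (fun x => f x = 0).
Proof.
by split=> [|a x y fx fy]; rewrite ?linear0 // linearP fx fy scaler0 addr0.
Qed.

Lemma linear_submod_img A B (f : {linear A -> B}) :
  is_submodule (fun y => exists x, f x = y).
Proof.
split=> [|a x y [u <-] [v <-]]; first by exists 0; rewrite linear0.
by exists (a *: u + v); rewrite linearP.
Qed.

Lemma ses_of_surj A B (p : {linear A -> B}) :
  (forall z, exists x, p x = z) ->
  exists K (i : {linear K -> A}), ses i p.
Proof.
move=> p_surj; have [K [i [i_inj iP]]] := submodule_exists (linear_submod_ker p).
by exists K, i.
Qed.

Lemma ses_of_inj A B (i : {linear A -> B}) :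
  injective i -> exists C (p : {linear B -> C}), ses i p.
Proof.
move=> i_inj; have [C [p [p_surj pP]]] := quotient_exists (linear_submod_img i).
by exists C, p.
Qed.

Lemma image_factor A B (f : {linear A -> B}) :
  exists I (q : {linear A -> I}) (j : {linear I -> B}),
    [/\ forall y, exists x, q x = y, injective j & forall x, j (q x) = f x].
Proof.
have [I [j [j_inj jP]]] := submodule_exists (linear_submod_img f).
have [|q qE] := factor_inj j_inj (f := f); first by move=> x; apply/jP; exists x.
exists I, q, j; split=> // y.
have [x fx] : exists x, f x = j y by apply/jP; exists y.
by exists x; apply: j_inj; rewrite qE.
Qed.

(** [X] is the quotient of [N * B] by the elements [(f a, - i a)]; injectivity of [i] keeps [N]
    embedded. *)
Lemma pushout A B C N (i : {linear A -> B}) (p : {linear B -> C})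
    (f : {linear A -> N}) : ses i p ->
  exists X (j : {linear N -> X}) (q : {linear X -> C}) (g : {linear B -> X}),
    [/\ ses j q, forall x, g (i x) = j (f x) & forall x, q (g x) = p x].
Proof.
move=> ip; have [i_inj exP p_surj] := ip.
pose P (x : (N * B)%type) := exists a, (f a, - i a) = x.
have subP : is_submodule P.
  split=> [|c x y [a <-] [b <-]]; first by exists 0; rewrite !linear0.
  exists (c *: a + b); rewrite !linearP /=; congr pair.
have [X [r [r_surj rP]]] := quotient_exists subP.
have lj : linear (fun y : N => r (y, 0)).
  move=> c x y; rewrite -linearP; congr (r _); congr pair => /=.
  by rewrite scaler0 addr0.
have lg : linear (fun y : B => r (0, y)).
  move=> c x y; rewrite -linearP; congr (r _); congr pair => /=.
  by rewrite scaler0 addr0.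
have lp : linear (fun y : (N * B)%type => p y.2) by move=> c x y; rewrite -linearP.
have [|q qE] := factor_surj r_surj (f := lin_of lp).
  move=> x /rP[a <-] /=; rewrite linearN (ses_comp0 _ ip). exact: oppr0.
exists X, (lin_of lj), q, (lin_of lg).
have rE (y : N) (b : B) : r (y, b) = r (y, 0) + r (0, b).
  by rewrite -linearD; congr (r _); congr pair; rewrite ?addr0 ?add0r.
split=> [|x|x]; last by rewrite qE.
- split=> [x y /= /eqP|x|z].
  + rewrite -subr_eq0 -linearB => /eqP/rP[a [e1 /eqP]].
    rewrite subr0 oppr_eq0 => /eqP ia0.
    apply/eqP; rewrite -subr_eq0 -e1 (_ : a = 0) ?linear0 //.
    by apply: i_inj; rewrite linear0.
  + have [[y b] <-] := r_surj x; rewrite qE; split=> /=.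
      move/exP => [a <-]; exists (y + f a); apply/eqP; rewrite -subr_eq0 -linearB.
      apply/eqP/rP; exists a; congr pair; first by rewrite /= addrC addKr.
      by rewrite /= sub0r.
    by move=> [y' e]; move: (qE (y, b)); rewrite -e qE /= linear0 => <-.
  + have [b <-] := p_surj z; exists (r (0, b)); exact: qE.
- apply/eqP; rewrite eq_sym -subr_eq0 /= -linearB; apply/eqP/rP; exists x.
  by congr pair; rewrite /= ?subr0 ?sub0r.
Qed.

(** [X] is the submodule of [M * B] on which [f] and [p] agree; [A] is the kernel of its projection
    to [M]. *)
Lemma pullback A B C M (i : {linear A -> B}) (p : {linear B -> C})
    (f : {linear M -> C}) : ses i p ->
  exists X (j : {linear A -> X}) (q : {linear X -> M}) (g : {linear X -> B}),
    [/\ ses j q, forall x, g (j x) = i x & forall x, p (g x) = f (q x)].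
Proof.
move=> ip; have [i_inj exP p_surj] := ip.
pose P (x : (M * B)%type) := p x.2 = f x.1.
have subP : is_submodule P.
  split=> [|c [x b] [y b']]; rewrite /P /= ?linear0 // => e1 e2.
  by rewrite !linearP e1 e2.
have [X [k [k_inj kP]]] := submodule_exists subP.
have l0 : linear (fun a : A => (0 : M, i a)).
  by move=> c x y; rewrite linearP; congr pair; rewrite /= scaler0 addr0.
have [|j jE] := factor_inj k_inj (f := lin_of l0).
  by move=> x; apply/kP; rewrite /P /= linear0 (ses_comp0 _ ip).
have l1 : linear (fun x : (M * B)%type => x.1) by [].
have l2 : linear (fun x : (M * B)%type => x.2) by [].
exists X, j, (lin_of l1 \o k), (lin_of l2 \o k); split=> [|x|x] /=.
- split=> [x y e|x|z] /=.
  + by apply: i_inj; have := jE x; rewrite e jE => -[].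
  + split=> [kx0|[y <-]]; last by rewrite jE.
    have : P (k x) by apply/kP; exists x.
    rewrite /P kx0 linear0 => /exP[y yE]; exists y; apply: k_inj.
    by rewrite jE /= yE -kx0; case: (k x).
  + have [b bE] := p_surj (f z).
    by have [|s sE] := (kP (z, b)).1; [exact: bE | exists s; rewrite sE].
- by rewrite jE.
- by apply/kP; exists x.
Qed.

(** Working form of Ext^1(M, N) = 0: splitting by a section replaces the equivalence of extensions
    in [Ext1_zero]. *)
Definition ext_vanish M N : Prop :=
  forall X (i : {linear N -> X}) (p : {linear X -> M}), ses i p ->
  exists s : {linear M -> X}, forall z, p (s z) = z.

Lemma ext_vanish_retract M N X (i : {linear N -> X}) (p : {linear X -> M}) :
  ext_vanish M N -> ses i p ->
  exists r : {linear X -> N}, forall y, r (i y) = y.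
Proof.
move=> E ip; have [s sE] := E _ _ _ ip; have [i_inj exP _] := ip.
have l : linear (fun x => x - s (p x)).
  by move=> a x y; rewrite !linearP addrACA -scalerDr.
have [|r rE] := factor_inj i_inj (f := lin_of l).
  by move=> x; apply/exP; rewrite /= linearB sE subrr.
by exists r => y; apply: i_inj; rewrite rE /= (ses_comp0 _ ip) linear0 subr0.
Qed.

Lemma ext_vanish_of_retract M N :
  (forall X (i : {linear N -> X}) (p : {linear X -> M}), ses i p ->
   exists r : {linear X -> N}, forall y, r (i y) = y) -> ext_vanish M N.
Proof.
move=> E X i p ip; have [r rE] := E _ _ _ ip; have [i_inj exP p_surj] := ip.
have l : linear (fun x => x - i (r x)).
  by move=> a x y; rewrite !linearP addrACA -scalerDr.
have [|s sE] := factor_surj p_surj (f := lin_of l).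
  by move=> x /exP[y <-] /=; rewrite rE subrr.
exists s => z; have [x <-] := p_surj z.
by rewrite sE /= linearB (ses_comp0 _ ip) subr0.
Qed.

(** A retraction of the pushout along [f] turns the pushout map into the required extension. *)
Lemma ext_extend A B C N (i : {linear A -> B}) (p : {linear B -> C})
    (f : {linear A -> N}) : ses i p -> ext_vanish C N ->
  exists g : {linear B -> N}, forall x, g (i x) = f x.
Proof.
move=> ip E; have [X [j [q [g [jq gi qg]]]]] := pushout f ip.
have [r rE] := ext_vanish_retract E jq.
by exists (r \o g) => x /=; rewrite gi rE.
Qed.

Lemma ext_lift A B C M (i : {linear A -> B}) (p : {linear B -> C})
    (f : {linear M -> C}) : ses i p -> ext_vanish M A ->
  exists g : {linear M -> B}, forall x, p (g x) = f x.
Proof.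
move=> ip E; have [X [j [q [g [jq gj pg]]]]] := pullback f ip.
have [s sE] := E _ _ _ jq.
by exists (g \o s) => x /=; rewrite pg sE.
Qed.

Lemma Ext1_zero_vanish M N : Ext1_zero M N -> ext_vanish M N.
Proof.
move=> E; apply: ext_vanish_of_retract => X i p [i_inj exP p_surj].
have [f [_ fi _]] := E (Extension i_inj exP p_surj).
have l1 : linear (fun x : (N * M)%type => x.1) by [].
exists (lin_of l1 \o f) => y /=.
by rewrite -[i y]/(ext_inj (Extension i_inj exP p_surj) y) fi.
Qed.
End Maps.

(** * Projective presentations *)

Section Presentations.
Variable R : nzRingType.
Implicit Types A B C D E F I K L M N P Q S T X Y Z : lmodType R.

Lemma projective_lift P A B (g : {linear A -> B}) (f : {linear P -> B}) :
  projective P -> (forall x, exists a, g a = f x) ->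
  exists h : {linear P -> A}, forall x, g (h x) = f x.
Proof.
move=> projP fg; have [I [q [j [q_surj j_inj jq]]]] := image_factor g.
have [|f' f'E] := factor_inj j_inj (f := f).
  by move=> x; have [a <-] := fg x; exists (q a).
have [h hE] := projP _ _ q f' q_surj.
by exists h => x; rewrite -jq hE.
Qed.

(* For a projective resolution 0 -> P1 -> P0 -> E -> 0 with first map [i],
   [hom_vanish i N] means Hom(E, N) = 0 and [extensible i N] means
   Ext^1(E, N) = 0. *)
Definition hom_vanish P1 P0 (i : {linear P1 -> P0}) N : Prop :=
  forall w : {linear P0 -> N}, (forall x, w (i x) = 0) -> forall x, w x = 0.

Definition extensible P1 P0 (i : {linear P1 -> P0}) N : Prop :=
  forall u : {linear P1 -> N},
  exists w : {linear P0 -> N}, forall x, w (i x) = u x.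

Definition perp P1 P0 (i : {linear P1 -> P0}) N : Prop :=
  hom_vanish i N /\ extensible i N.

(* For [i] as above, this says that the total complex of
   Hom(P0, M) -> Hom(P1, M) + Hom(P0, N) -> Hom(P1, N)
   is exact, i.e. that [f] induces isomorphisms on Hom(E, -) and Ext^1(E, -). *)
Definition acyclic P1 P0 (i : {linear P1 -> P0}) M N (f : {linear M -> N}) : Prop :=
  [/\ forall w : {linear P0 -> M},
        (forall x, w (i x) = 0) -> (forall x, f (w x) = 0) -> forall x, w x = 0,
      forall (u : {linear P1 -> M}) (v : {linear P0 -> N}),
        (forall x, f (u x) = v (i x)) ->
        exists w : {linear P0 -> M},
          (forall x, w (i x) = u x) /\ (forall x, f (w x) = v x)
    & forall z : {linear P1 -> N}, exists (u : {linear P1 -> M}) (v : {linear P0 -> N}),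
        forall x, z x = f (u x) + v (i x)].

(** * Perpendicularity and acyclic maps along exact sequences *)

Section Perp.
Variables (P1 P0 : lmodType R) (i : {linear P1 -> P0}).

Lemma hom_vanish_sub N M (j : {linear N -> M}) :
  injective j -> hom_vanish i M -> hom_vanish i N.
Proof.
move=> j_inj HM w wi0 x; apply: j_inj; rewrite linear0.
by apply: (HM (j \o w)) => y /=; rewrite wi0 linear0.
Qed.

Lemma extensible_retract N M (s : {linear N -> M}) (r : {linear M -> N}) :
  cancel s r -> extensible i M -> extensible i N.
Proof.
move=> sK EM u; have [w wE] := EM (s \o u).
by exists (r \o w) => x /=; rewrite wE /= sK.
Qed.

Lemma perp_retract N M (s : {linear N -> M}) (r : {linear M -> N}) :
  cancel s r -> perp i M -> perp i N.
Proof.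
move=> sK [HM EM]; split; last exact: extensible_retract sK EM.
exact: hom_vanish_sub (can_inj sK) HM.
Qed.

Lemma hom_vanish_ext A B C (j : {linear A -> B}) (q : {linear B -> C}) :
  ses j q -> hom_vanish i A -> hom_vanish i C -> hom_vanish i B.
Proof.
move=> jq HA HC w wi0; have [j_inj exq _] := jq.
have qw0 : forall x, q (w x) = 0.
  by apply: (HC (q \o w)) => x /=; rewrite wi0 linear0.
have [|w' w'E] := factor_inj j_inj (f := w); first by move=> x; apply/exq.
move=> x; rewrite -w'E HA ?linear0 // => y.
by apply: j_inj; rewrite w'E wi0 linear0.
Qed.

Lemma extensible_surj M N (q : {linear M -> N}) :
  projective P1 -> (forall y, exists x, q x = y) -> extensible i M -> extensible i N.
Proof.
move=> proj1 q_surj EM u; have [v vE] := proj1 _ _ q u q_surj.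
by have [w wE] := EM v; exists (q \o w) => x /=; rewrite wE.
Qed.

Lemma extensible_ext A B C (j : {linear A -> B}) (q : {linear B -> C}) :
  projective P0 -> ses j q -> extensible i A -> extensible i C -> extensible i B.
Proof.
move=> proj0 [j_inj exq q_surj] EA EC u.
have [w wE] := EC (q \o u); have [v vE] := proj0 _ _ q w q_surj.
have [|u' u'E] := factor_inj j_inj (f := u \- (v \o i)).
  by move=> x; apply/exq; rewrite /= linearB vE wE /= subrr.
have [w' w'E] := EA u'.
by exists (v \+ (j \o w')) => x /=; rewrite w'E u'E /= addrC subrK.
Qed.

(** A map from the resolved module to [C] lifts to [v : P0 -> B], which sends [P1] into the image of
    [A]. Extending over [P0] by [extensible i A] corrects [v], and the last hypothesis then places
    it in the image of [f]. *)
Lemma hom_vanish_coker A B C (f : {linear A -> B}) (q : {linear B -> C}) :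
  projective P1 -> projective P0 ->
  (forall y, exists x, q x = y) -> (forall x, q x = 0 <-> exists a, f a = x) ->
  extensible i A ->
  (forall v : {linear P0 -> B}, (forall x, v (i x) = 0) ->
     exists t : {linear P0 -> A}, forall x, f (t x) = v x) ->
  hom_vanish i C.
Proof.
move=> proj1 proj0 q_surj exq EA HB w wi0.
have [v vE] := proj0 _ _ q w q_surj.
have [|u uE] := projective_lift (g := f) (f := v \o i) proj1.
  by move=> x; apply/exq; rewrite /= vE.
have [w' w'E] := EA u.
have [|t tE] := HB (v \- (f \o w')); first by move=> x /=; rewrite w'E uE /= subrr.
move=> x; rewrite -vE; apply/exq; exists (w' x + t x).
by rewrite linearD tE /= addrC subrK.
Qed.

(** Extend first into [A]. The obstruction to staying in [K] is a map from the resolved module to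
    [B]; by the last hypothesis it comes from one to [A], which is subtracted. *)
Lemma extensible_ker K A B (j : {linear K -> A}) (f : {linear A -> B}) :
  injective j -> (forall x, f x = 0 <-> exists y, j y = x) -> extensible i A ->
  (forall w : {linear P0 -> A}, (forall x, f (w (i x)) = 0) ->
     exists t : {linear P0 -> A},
       (forall x, t (i x) = 0) /\ forall x, f (t x) = f (w x)) ->
  extensible i K.
Proof.
move=> j_inj exf EA HB u; have [w wE] := EA (j \o u).
have [|t [ti0 ft]] := HB w.
  by move=> x; apply/exf; exists (u x); rewrite wE.
have [|w' w'E] := factor_inj j_inj (f := w \- t).
  by move=> x; apply/exf; rewrite /= linearB ft subrr.
by exists w' => x; apply: j_inj; rewrite w'E /= ti0 wE subr0.
Qed.

Lemma acyclic_id M : acyclic i (@idfun M).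
Proof.
split=> [w _ w0 //|u v uv|z].
- by exists v; split=> // x; rewrite -uv.
- exists z, \0 => x /=; by rewrite addr0.
Qed.

Lemma acyclic_comp L M N (f : {linear L -> M}) (g : {linear M -> N}) :
  acyclic i f -> acyclic i g -> acyclic i (g \o f).
Proof.
move=> [fa fb fc] [ga gb gc]; split=> [w wi0 gfw0|u v uv|z].
- apply: fa => //; apply: (ga (f \o w)) => // x.
  by rewrite /= wi0 linear0.
- have [w1 [w1i gw1]] := gb (f \o u) v uv.
  have [|w [wi fw]] := fb u w1; first by move=> x; rewrite w1i.
  by exists w; split=> // x; rewrite /= fw gw1.
- have [u1 [v uv]] := gc z; have [u [v' uv']] := fc u1.
  exists u, ((g \o v') \+ v) => x /=.
  by rewrite uv uv' linearD addrA.
Qed.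

Lemma acyclic_inj M N C (f : {linear M -> N}) (q : {linear N -> C}) :
  projective P0 -> ses f q -> hom_vanish i C -> extensible i C -> acyclic i f.
Proof.
move=> proj0 fq HC EC; have [f_inj exq q_surj] := fq.
split=> [w _ fw0 x|u v uv|z].
- by apply: f_inj; rewrite fw0 linear0.
- have qv0 : forall x, q (v x) = 0.
    by apply: (HC (q \o v)) => x /=; rewrite -uv (ses_comp0 _ fq).
  have [|w wE] := factor_inj f_inj (f := v); first by move=> x; apply/exq.
  by exists w; split=> // x; apply: f_inj; rewrite wE uv.
- have [w wE] := EC (q \o z); have [v vE] := proj0 _ _ q w q_surj.
  have [|u uE] := factor_inj f_inj (f := z \- (v \o i)).
    by move=> x; apply/exq; rewrite /= linearB vE wE subrr.
  by exists u, v => x; rewrite uE /= subrK.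
Qed.

Lemma acyclic_surj K M N (j : {linear K -> M}) (f : {linear M -> N}) :
  projective P1 -> projective P0 ->
  ses j f -> hom_vanish i K -> extensible i K -> acyclic i f.
Proof.
move=> proj1 proj0 jf HK EK; have [j_inj exf f_surj] := jf.
split=> [w wi0 fw0|u v uv|z].
- have [|w' w'E] := factor_inj j_inj (f := w); first by move=> x; apply/exf.
  move=> x; rewrite -w'E HK ?linear0 // => y.
  by apply: j_inj; rewrite w'E wi0 linear0.
- have [w0 w0E] := proj0 _ _ f v f_surj.
  have [|u' u'E] := factor_inj j_inj (f := u \- (w0 \o i)).
    by move=> x; apply/exf; rewrite /= linearB w0E uv subrr.
  have [w1 w1E] := EK u'.
  exists (w0 \+ (j \o w1)); split=> x /=; first by rewrite w1E u'E /= addrC subrK.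
  by rewrite linearD (ses_comp0 _ jf) addr0 w0E.
- have [u uE] := proj1 _ _ f z f_surj.
  by exists u, \0 => x /=; rewrite addr0.
Qed.

(** The first condition of [acyclic] gives the Hom part, and the second, with [v] zero, the Ext
    part. *)
Lemma acyclic_ker K M N (j : {linear K -> M}) (f : {linear M -> N}) :
  injective j -> (forall x, f x = 0 <-> exists y, j y = x) -> acyclic i f ->
  perp i K.
Proof.
move=> j_inj exf [fa fb _]; split=> [w wi0 x|u].
  apply: j_inj; rewrite linear0; apply: (fa (j \o w)) => y /=.
    by rewrite wi0 linear0.
  by apply/exf; exists (w y).
have [|w [wi fw]] := fb (j \o u) \0.
  by move=> x; apply/exf; exists (u x).
have [|w' w'E] := factor_inj j_inj (f := w); first by move=> x; apply/exf.
by exists w' => x; apply: j_inj; rewrite w'E wi.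
Qed.

(** After lifting along [q] by projectivity, the second condition of [acyclic] gives the Hom part
    and the third the Ext part. *)
Lemma acyclic_coker M N C (f : {linear M -> N}) (q : {linear N -> C}) :
  projective P1 -> projective P0 ->
  (forall y, exists x, q x = y) -> (forall x, q x = 0 <-> exists a, f a = x) ->
  acyclic i f -> perp i C.
Proof.
move=> proj1 proj0 q_surj exq [_ fb fc]; split=> [t ti0 x|z].
  have [v vE] := proj0 _ _ q t q_surj.
  have [|u uE] := projective_lift (g := f) (f := v \o i) proj1.
    by move=> y; apply/exq; rewrite /= vE.
  have [w [_ fw]] := fb u v uE.
  by rewrite -vE; apply/exq; exists (w x); rewrite fw.
have [z' z'E] := proj1 _ _ q z q_surj.
have [u [v uv]] := fc z'; exists (q \o v) => x /=.
rewrite -z'E uv linearD (_ : q (f (u x)) = 0) ?add0r //.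
by apply/exq; exists (u x).
Qed.
End Perp.

(** Ext^1(A, N) = 0 lifts [i] to [Z]; dividing [Z] by the image of this lift leaves an extension of
    [C] by [N], whose retraction gives one for [Z]. *)
Lemma ext_vanish_mid A B C N (i : {linear A -> B}) (p : {linear B -> C}) :
  ses i p -> ext_vanish A N -> ext_vanish C N -> ext_vanish B N.
Proof.
move=> ip EA EC; apply: ext_vanish_of_retract => Z k q kq.
have [i_inj exp p_surj] := ip; have [k_inj exq q_surj] := kq.
have [s sE] := ext_lift i kq EA.
have s_inj : injective s by move=> x y e; apply: i_inj; rewrite -!sE e.
have [W [pi [_ expi pi_surj]]] := ses_of_inj s_inj.
have [|q' q'E] := factor_surj pi_surj (f := p \o q).
  by move=> x /expi[a <-] /=; rewrite sE (ses_comp0 _ ip).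
have kq' : ses (pi \o k) q'.
  split=> [x y /= /eqP|w|z].
  - rewrite -subr_eq0 -!linearB => /eqP/expi[a sa]; apply/eqP.
    rewrite -subr_eq0; apply/eqP/k_inj; rewrite linear0 -sa (_ : a = 0) ?linear0 //.
    by apply: i_inj; rewrite -sE sa (ses_comp0 _ kq) linear0.
  - have [z <-] := pi_surj w; split=> [|[y <-]].
      rewrite q'E /= => /exp[a ia].
      have /exq[y ky] : q (z - s a) = 0 by rewrite linearB sE ia subrr.
      exists y => /=; rewrite ky linearB (_ : pi (s a) = 0) ?subr0 //.
      by apply/expi; exists a.
    by rewrite q'E /= (ses_comp0 _ kq) linear0.
  - have [b <-] := p_surj z; have [x <-] := q_surj b; exists (pi x); exact: q'E.
have [r rE] := ext_vanish_retract EC kq'.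
by exists (r \o pi) => y; rewrite /= rE.
Qed.

(** A lift of [q] through the extension sends [I] into [N], hence to zero, so it descends to a
    section on [C]. *)
Lemma ext_vanish_coker I X C N (j : {linear I -> X}) (q : {linear X -> C}) :
  ses j q -> (forall (f : {linear I -> N}) x, f x = 0) -> ext_vanish X N ->
  ext_vanish C N.
Proof.
move=> jq HI EX Z k p kp; have [_ exq q_surj] := jq; have [k_inj exp _] := kp.
have [g gE] := ext_lift q kp EX.
have [|f fE] := factor_inj k_inj (f := g \o j).
  by move=> x; apply/exp; rewrite /= gE (ses_comp0 _ jq).
have [|s sE] := factor_surj q_surj (f := g).
  by move=> x /exq[y <-]; rewrite -[LHS]fE HI linear0.
by exists s => z; have [x <-] := q_surj z; rewrite sE gE.
Qed.

(** This is Ext^2 = 0 in elementary form. The preimage [Q] of [I] in [F] is projective, and an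
    extension of [I] by [N] is given by a map to [N] from the kernel [L] of [pi]. That map extends
    to [F] because Ext^1(X, N) = 0, so the extension splits. *)
Lemma ext_vanish_sub F X I N (pi : {linear F -> X}) (j : {linear I -> X}) :
  (forall Q (h : {linear Q -> F}), injective h -> projective Q) ->
  (forall x, exists y, pi y = x) -> injective j -> ext_vanish X N ->
  ext_vanish I N.
Proof.
move=> Fher pi_surj j_inj EX Z k q kq; have [k_inj exq q_surj] := kq.
have subQ : is_submodule (fun y => exists x, j x = pi y).
  split=> [|a x y [u ux] [v vy]]; first by exists 0; rewrite !linear0.
  by exists (a *: u + v); rewrite !linearP ux vy.
have [Q [h [h_inj hP]]] := submodule_exists subQ.
have [|g gE] := factor_inj j_inj (f := pi \o h).
  by move=> x; apply/hP; exists x.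
have g_surj y : exists x, g x = y.
  have [z zE] := pi_surj (j y).
  have [|x xE] := (hP z).1; first by exists y.
  by exists x; apply: j_inj; rewrite gE /= xE.
have [l lE] := Fher _ _ h_inj _ _ q g q_surj.
have [L [m mpi]] := ses_of_surj pi_surj; have [m_inj expi _] := mpi.
have [|m' m'E] := factor_inj h_inj (f := m).
  by move=> x; apply/hP; exists 0; rewrite (ses_comp0 _ mpi) linear0.
have gm' x : g (m' x) = 0.
  by apply: j_inj; rewrite gE /= m'E (ses_comp0 _ mpi) linear0.
have [|t tE] := factor_inj k_inj (f := l \o m').
  by move=> x; apply/exq; rewrite /= lE.
have [t' t'E] := ext_extend t mpi EX.
have [|s sE] := factor_surj g_surj (f := l \- (k \o t' \o h)).
  move=> x gx0; have /expi[y yE] : pi (h x) = 0.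
    by have := gE x; rewrite gx0 linear0.
  have <- : m' y = x by apply: h_inj; rewrite m'E.
  by rewrite /= m'E t'E tE subrr.
exists s => z; have [x <-] := g_surj z.
by rewrite sE /= linearB lE (ses_comp0 _ kq) subr0.
Qed.

Lemma projective_ext A B C (i : {linear A -> B}) (p : {linear B -> C}) :
  ses i p -> projective A -> projective C -> projective B.
Proof.
move=> ip projA projC X Y g f g_surj; have [i_inj exp p_surj] := ip.
have [s sE] := projC _ _ p idfun p_surj.
have [|r rE] := factor_inj i_inj (f := idfun \- (s \o p)).
  by move=> x; apply/exp; rewrite /= linearB sE subrr.
have [hA hAE] := projA _ _ g (f \o i) g_surj.
have [hC hCE] := projC _ _ g (f \o s) g_surj.
exists ((hA \o r) \+ (hC \o p)) => x /=.
by rewrite linearD hAE hCE /= -linearD rE /= subrK.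
Qed.

(** * Finite powers of a module *)

Definition ffun_proj M n (l : 'I_n) (x : {ffun 'I_n -> M}) : M := x l.
Definition ffun_inj M n (l : 'I_n) (y : M) : {ffun 'I_n -> M} :=
  [ffun j => if j == l then y else 0].
Fact ffun_proj_linear M n l : linear (@ffun_proj M n l).
Proof. by move=> a x y; rewrite /ffun_proj !ffunE. Qed.
Fact ffun_inj_linear M n l : linear (@ffun_inj M n l).
Proof.
move=> a x y; apply/ffunP=> j; rewrite !ffunE.
by case: eqP => // _; rewrite scaler0 addr0.
Qed.
HB.instance Definition _ M n l :=
  GRing.isLinear.Build R {ffun 'I_n -> M} M _ _ (@ffun_proj_linear M n l).
HB.instance Definition _ M n l :=
  GRing.isLinear.Build R M {ffun 'I_n -> M} _ _ (@ffun_inj_linear M n l).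

Lemma ffun_sum_inj M n (x : {ffun 'I_n -> M}) : x = \sum_l ffun_inj l (x l).
Proof.
apply/ffunP=> j; rewrite sum_ffunE (bigD1 j) //= ffunE eqxx big1 ?addr0 // => l lj.
by rewrite ffunE eq_sym (negPf lj).
Qed.

Lemma ffun_copair M N n (f : 'I_n -> {linear M -> N}) :
  exists g : {linear {ffun 'I_n -> M} -> N},
    (forall x, g x = \sum_l f l (x l)) /\ forall l y, g (ffun_inj l y) = f l y.
Proof.
have lg : linear (fun x : {ffun 'I_n -> M} => \sum_l f l (x l)).
  move=> a x y; rewrite scaler_sumr -big_split /=; apply: eq_bigr => l _.
  by rewrite !ffunE linearP.
exists (lin_of lg); split=> // l y /=.
rewrite (bigD1 l) //= ffunE eqxx big1 ?addr0 // => j jl.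
by rewrite ffunE (negPf jl) linear0.
Qed.

Lemma ffun_pair M N n (f : 'I_n -> {linear M -> N}) :
  exists g : {linear M -> {ffun 'I_n -> N}}, forall x l, g x l = f l x.
Proof.
have lg : linear (fun x => [ffun l => f l x] : {ffun 'I_n -> N}).
  by move=> a x y; apply/ffunP=> l; rewrite !ffunE linearP.
by exists (lin_of lg) => x l; rewrite /= ffunE.
Qed.

Lemma perp_ffun P1 P0 (i : {linear P1 -> P0}) N n :
  perp i N -> perp i {ffun 'I_n -> N}.
Proof.
move=> [HN EN]; split=> [w wi0 x|u].
  apply/ffunP=> l; rewrite [RHS]ffunE.
  by apply: (HN (ffun_proj l \o w)) => y /=; rewrite wi0 linear0.
have [w wE] := choice (fun l => EN (ffun_proj l \o u)).
have [g gE] := ffun_pair w.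
by exists g => x; apply/ffunP=> l; rewrite gE wE.
Qed.

Lemma extensible_ffun P1 P0 (i : {linear P1 -> P0}) N n :
  extensible i N -> extensible i {ffun 'I_n -> N}.
Proof.
move=> EN u; have [w wE] := choice (fun l => EN (ffun_proj l \o u)).
have [g gE] := ffun_pair w.
by exists g => x; apply/ffunP=> l; rewrite gE wE.
Qed.

Lemma ext_vanish_ffun M N n :
  ext_vanish M N -> ext_vanish {ffun 'I_n -> M} N.
Proof.
move=> EM X j q jq.
have [f fE] := choice (fun l : 'I_n => ext_lift (ffun_inj l) jq EM).
have [g [gE _]] := ffun_copair f; exists g => z.
by rewrite gE linear_sum [RHS]ffun_sum_inj; apply: eq_bigr => l _; rewrite fE.
Qed.

Lemma hom_zero_ffun M N n : Hom_zero M N -> Hom_zero {ffun 'I_n -> M} N.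
Proof.
move=> HM f x; rewrite (ffun_sum_inj x) linear_sum big1 // => l _.
exact: (HM (f \o ffun_inj l)).
Qed.

Definition presentation P1 P0 E (i : {linear P1 -> P0}) (p : {linear P0 -> E}) :=
  [/\ projective P1, projective P0 & ses i p].

(** A lift [v] of [p] to an extension restricts to a map from [P1] to [N]; once this is extended to
    [P0] and subtracted, [v] descends to a section. *)
Lemma extensible_ext_vanish P1 P0 E N (i : {linear P1 -> P0}) (p : {linear P0 -> E}) :
  presentation i p -> extensible i N <-> ext_vanish E N.
Proof.
move=> [proj1 proj0 ip]; split=> [EN X j q jq|EN u]; last exact: ext_extend u ip EN.
have [j_inj exq q_surj] := jq; have [_ exp p_surj] := ip.
have [v vE] := proj0 _ _ q p q_surj.
have [|u uE] := factor_inj j_inj (f := v \o i).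
  by move=> x; apply/exq; rewrite /= vE (ses_comp0 _ ip).
have [w wE] := EN u.
have [|s sE] := factor_surj p_surj (f := v \- (j \o w)).
  by move=> x /exp[y <-] /=; rewrite wE uE subrr.
exists s => z; have [x <-] := p_surj z.
by rewrite sE /= linearB vE (ses_comp0 _ jq) subr0.
Qed.

Lemma hom_vanish_zero P1 P0 E N (i : {linear P1 -> P0}) (p : {linear P0 -> E}) :
  ses i p -> hom_vanish i N <-> Hom_zero E N.
Proof.
move=> ip; have [_ exp p_surj] := ip; split=> [HN f z|HN w wi0 x].
  have [x <-] := p_surj z; apply: (HN (f \o p)) => y /=.
  by rewrite (ses_comp0 _ ip) linear0.
have [|f fE] := factor_surj p_surj (f := w); first by move=> y /exp[y' <-].
by rewrite -fE HN.
Qed.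

(** Induction on [n]: the image [I] of the first coordinate is a left ideal, the kernel [K] embeds
    in the remaining coordinates, and an extension of projectives is projective. *)
Lemma hereditary_free n (H_hereditary : hereditary R) Q
  (h : {linear Q -> {ffun 'I_n -> R^o}}) : injective h -> projective Q.
Proof.
elim: n => [|n IH] in Q h *.
  move=> h_inj A B g f _; exists \0 => x /=.
  rewrite linear0 (_ : x = 0) ?linear0 //; apply: h_inj.
  by apply/ffunP; case.
move=> h_inj.
have [I [q [j [q_surj j_inj jq]]]] := image_factor (ffun_proj ord0 \o h).
have [K [k kq]] := ses_of_surj q_surj; have [k_inj _ _] := kq.
have [r rE] := ffun_pair (fun l : 'I_n => ffun_proj (lift ord0 l) \o h \o k).
apply: (projective_ext kq (IH K r _) (H_hereditary _ _ j_inj)) => x y e.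
apply/k_inj/h_inj/ffunP => l; case: (unliftP ord0 l) => [l'|] ->.
  by have := congr1 (ffun_proj l') e; rewrite /ffun_proj !rE.
by rewrite -[LHS]/((ffun_proj ord0 \o h) _) -[RHS]/((ffun_proj ord0 \o h) _)
           -!jq !(ses_comp0 _ kq).
Qed.

Lemma fg_free_cover M : finitely_generated M ->
  exists n (f : {linear {ffun 'I_n -> R^o} -> M}), forall y, exists x, f x = y.
Proof.
move=> [n [g gP]].
have lf : linear (fun x : {ffun 'I_n -> R^o} => \sum_l x l *: g l).
  move=> a x y; rewrite scaler_sumr -big_split /=; apply: eq_bigr => l _.
  by rewrite !ffunE scalerDl scalerA.
exists n, (lin_of lf) => y; have [c ->] := gP y.
by exists [ffun l => c l]; apply: eq_bigr => l _; rewrite ffunE.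
Qed.
End Presentations.

(** * Finite-dimensional modules *)

(** A subspace of maximal dimension among those contained in [P] exhausts [P]. *)
Lemma vspace_of_submod (k : fieldType) (V : vectType k) (P : V -> Prop) :
  P 0 -> (forall a x y, P x -> P y -> P (a *: x + y)) ->
  exists W : {vspace V}, forall v, v \in W <-> P v.
Proof.
move=> P0 Plin.
pose Q d := `[< exists W : {vspace V}, \dim W = d /\ forall v, v \in W -> P v >].
have Q0 : exists d, Q d.
  exists 0%N; apply/asboolP; exists 0%VS; rewrite dimv0; split=> // v.
  by rewrite memv0 => /eqP ->.
have Qmax d : Q d -> (d <= \dim {:V})%N.
  by move=> /asboolP[W [<- _]]; apply: dimvS; apply: subvf.
case: (ex_maxnP Q0 Qmax) => d /asboolP[W [dW WP]] dmax.
exists W => v; split=> [/WP //|Pv].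
have : Q (\dim (W + <[v]>)).
  apply/asboolP; exists (W + <[v]>)%VS; split=> // x /memv_addP[w wW [y /vlineP[a ->] ->]].
  by rewrite addrC; apply: Plin => //; apply: WP.
move/dmax => le_d; have /eqP e : (W == W + <[v]>)%VS.
  by rewrite eqEdim addvSl dW.
by rewrite memvE e addvSr.
Qed.

Lemma sum_pair_enum (V : nmodType) n m (F : 'I_n -> 'I_m -> V) :
  \sum_(s < #|{: 'I_n * 'I_m}|) F (enum_val s).1 (enum_val s).2 =
  \sum_l \sum_j F l j.
Proof.
rewrite pair_big /= -(big_enum_val (fun s : 'I_n * 'I_m => F s.1 s.2)).
exact: eq_bigl.
Qed.

Section FiniteDimensional.
Variables (k : fieldType) (H : falgType k).
Implicit Types A B C M N P S T : lmodType H.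

(** A separate name for the underlying type, so that the scalars of [k] do not clash with those of
    [H]. *)
Definition restrict N : Type := N.
HB.instance Definition _ N := GRing.Zmodule.on (restrict N).

Section RestrictScalars.
Variable N : lmodType H.
Definition restrict_scale (a : k) (x : restrict N) : restrict N :=
  a%:A *: (x : N).
Fact restrict_scaleA a b x :
  restrict_scale a (restrict_scale b x) = restrict_scale (a * b) x.
Proof. by rewrite /restrict_scale scalerA -scalerAl mul1r scalerA. Qed.
Fact restrict_scale1 : left_id 1 restrict_scale.
Proof. by move=> x; rewrite /restrict_scale !scale1r. Qed.
Fact restrict_scaleDr : right_distributive restrict_scale +%R.
Proof. by move=> a x y; rewrite /restrict_scale scalerDr. Qed.
Fact restrict_scaleDl x : {morph restrict_scale^~ x : a b / a + b}.
Proof. by move=> a b; rewrite /restrict_scale scalerDl scalerDl. Qed.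
HB.instance Definition _ := GRing.Zmodule_isLmodule.Build k (restrict N)
  restrict_scaleA restrict_scale1 restrict_scaleDr restrict_scaleDl.
End RestrictScalars.

Lemma scalar_comm N (a : k) (h : H) (x : N) : h *: (a%:A *: x) = a%:A *: (h *: x).
Proof. by rewrite !scalerA -scalerAr mulr1 -scalerAl mul1r. Qed.

Definition findim N : Prop :=
  exists d (g : 'I_d -> N), forall x, exists c : 'I_d -> k,
    x = \sum_l (c l)%:A *: g l.

(** A spanning family gives a linear map from row vectors onto the module; on a complement of its
    kernel it is bijective. *)
Lemma findim_coordinates N : findim N ->
  exists d (f : restrict N -> 'rV[k]_d), linear f /\ bijective f.
Proof.
move=> [d [g gP]].
pose f (c : 'rV[k]_d) : restrict N := \sum_l c 0 l *: (g l : restrict N).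
have lf : linear f.
  move=> a x y; rewrite scaler_sumr -big_split /=; apply: eq_bigr => l _.
  by rewrite !mxE scalerDl scalerA.
pose F := @lin_of k _ (restrict N) f lf.
have [K KP] : exists K : {vspace 'rV[k]_d}, forall v, v \in K <-> F v = 0.
  apply: vspace_of_submod => [|a x y fx fy]; first by rewrite linear0.
  by rewrite linearP fx fy scaler0 addr0.
pose V := subvs_of (K^C)%VS.
have lG : linear (fun v : V => F (vsval v)) by move=> a x y; rewrite !linearP.
pose G := @lin_of k _ (restrict N) _ lG.
have G_inj : injective G.
  move=> x y e; apply: val_inj.
  apply/eqP; rewrite -subr_eq0 -memv0 -(capv_compl K) memv_cap.
  apply/andP; split; last by rewrite memvB ?subvsP.
  apply/KP.
  by rewrite linearB; apply/eqP; rewrite subr_eq0; apply/eqP.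
have surj y : exists c, G c = y.
  have [c yc] := gP y.
  have : \row_l c l \in (K + K^C)%VS by rewrite addv_complf memvf.
  move=> /memv_addP[u uK [v vK uv]].
  exists (Subvs vK); rewrite -[LHS]/(F v).
  have -> : F v = F (u + v) by rewrite linearD (_ : F u = 0) ?add0r //; apply/KP.
  by rewrite -uv yc; apply: eq_bigr => l _; rewrite mxE.
have [h hK] := choice surj.
have Gh : cancel G h by move=> x; apply: G_inj; rewrite hK.
exists _, (v2r \o h); split.
  move=> a x y; rewrite /= -linearP; congr (v2r _); apply: G_inj.
  by rewrite linearP !hK.
by exists (G \o r2v) => x; rewrite /comp ?v2rK ?hK ?Gh ?r2vK.
Qed.

Lemma findim_axiom N : findim N -> {d : nat & Vector.axiom d (restrict N)}.
Proof.
by move=> /findim_coordinates/cid[d /cid[f [lf f_bij]]]; exists d, f.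
Qed.

Definition vmod N (hN : findim N) : vectType k :=
  HB.pack (restrict N)
    (Lmodule_hasFinDim.Build k (restrict N) (projT2 (findim_axiom hN))).

Definition generates P n (g : 'I_n -> P) : Prop :=
  forall x, exists c : 'I_n -> H, x = \sum_l c l *: g l.

Lemma generates_eq P n (g : 'I_n -> P) N (f1 f2 : {linear P -> N}) :
  generates g -> (forall l, f1 (g l) = f2 (g l)) -> forall x, f1 x = f2 x.
Proof.
move=> gP e x; have [c ->] := gP x; rewrite !linear_sum; apply: eq_bigr => l _.
by rewrite !linearZ /= e.
Qed.

(** * Dimensions of Hom spaces *)

Section HomSpace.
Variables (P : lmodType H) (n : nat) (g : 'I_n -> P).

(** A map is recorded by its values on [g], which embeds Hom(P, N) into a space of tuples when [g]
    generates. Closure under [k]-combinations rests on the centrality of [k] in [H]. *)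
Lemma hom_space_subproof N (hN : findim N) :
  exists W : {vspace {ffun 'I_n -> vmod hN}}, forall x, x \in W <->
    exists f : {linear P -> N}, forall l, f (g l) = x l.
Proof.
apply: vspace_of_submod => [|a x y [f fx] [f' f'x]].
  by exists \0 => l; rewrite ffunE.
have lf : linear (fun z => (a%:A *: f z + f' z)).
  by move=> b z z'; rewrite !linearP !scalerDr scalar_comm addrACA.
by exists (lin_of lf) => l; rewrite !ffunE /= fx f'x.
Qed.

Definition hom_space N (hN : findim N) := sval (cid (hom_space_subproof hN)).

Lemma hom_spaceP N (hN : findim N) (x : {ffun 'I_n -> vmod hN}) :
  x \in hom_space hN <-> exists f : {linear P -> N}, forall l, f (g l) = x l.
Proof. exact: (svalP (cid (hom_space_subproof hN))). Qed.

Definition homdim N (hN : findim N) : nat := \dim (hom_space hN).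

Section PostComposition.
Variables (A B : lmodType H) (hA : findim A) (hB : findim B) (f : {linear A -> B}).

Definition postcomp_fun (x : {ffun 'I_n -> vmod hA}) : {ffun 'I_n -> vmod hB} :=
  [ffun l => f (x l) : vmod hB].

Fact postcomp_linear : linear postcomp_fun.
Proof.
by move=> a x y; apply/ffunP=> l; rewrite !ffunE linearP.
Qed.

Definition postcomp := linfun (lin_of postcomp_linear).

Lemma postcompE x l : postcomp x l = f (x l).
Proof. by rewrite lfunE /= ffunE. Qed.
End PostComposition.

(** Composition with [p] is onto by projectivity and has kernel Hom(P, A); rank-nullity
    concludes. *)
Lemma homdim_ses A B C (i : {linear A -> B}) (p : {linear B -> C})
    (hA : findim A) (hB : findim B) (hC : findim C) :
  generates g -> projective P -> ses i p -> homdim hB = (homdim hA + homdim hC)%N.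
Proof.
move=> gP projP ip; have [i_inj exp p_surj] := ip.
have pW : (postcomp hB hC p @: hom_space hB = hom_space hC)%VS.
  apply/vspaceP => y; apply/memv_imgP/idP => [[x /hom_spaceP[f fx] ->]|/hom_spaceP[f fy]].
    by apply/hom_spaceP; exists (p \o f) => l; rewrite postcompE -fx.
  have [h hE] := projP _ _ p f p_surj.
  exists [ffun l => h (g l) : vmod hB].
    by apply/hom_spaceP; exists h => l; rewrite ffunE.
  by apply/ffunP=> l; rewrite postcompE ffunE hE fy.
have iW : (hom_space hB :&: lker (postcomp hB hC p) =
           postcomp hA hB i @: hom_space hA)%VS.
  apply/vspaceP => y; rewrite memv_cap; apply/andP/memv_imgP.
    move=> [/hom_spaceP[f fy]]; rewrite memv_ker => /eqP py0.
    have [|f' f'E] := factor_inj i_inj (f := f).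
      move=> x; apply/exp; apply: (generates_eq (f1 := p \o f) (f2 := \0) gP).
      move=> l /=; rewrite fy -(postcompE hC p) py0; exact: ffunE.
    exists [ffun l => f' (g l) : vmod hA].
      by apply/hom_spaceP; exists f' => l; rewrite ffunE.
    by apply/ffunP=> l; rewrite postcompE ffunE f'E fy.
  move=> [x /hom_spaceP[f fx] ->]; split.
    by apply/hom_spaceP; exists (i \o f) => l; rewrite postcompE -fx.
  rewrite memv_ker; apply/eqP/ffunP=> l.
  by rewrite !postcompE (ses_comp0 _ ip) [RHS]ffunE.
rewrite /homdim -(limg_ker_dim (postcomp hB hC p)) pW iW limg_dim_eq //.
apply/eqP; rewrite -subv0; apply/subvP => x; rewrite memv_cap memv_ker => /andP[_].
move=> /eqP x0; rewrite memv0; apply/eqP/ffunP => l; rewrite [RHS]ffunE.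
by apply: i_inj; rewrite -(postcompE hB i) x0 linear0 ffunE.
Qed.
End HomSpace.

Section Restriction.
Variables (P1 P0 : lmodType H) (i : {linear P1 -> P0}) (n1 n0 : nat).
Variables (g1 : 'I_n1 -> P1) (g0 : 'I_n0 -> P0).
Hypotheses (g1P : generates g1) (g0P : generates g0).
Variables (N : lmodType H) (hN : findim N).

Lemma restriction_map : exists F : 'Hom({ffun 'I_n0 -> vmod hN}, {ffun 'I_n1 -> vmod hN}),
  forall (x : {ffun 'I_n0 -> vmod hN}) (f : {linear P0 -> N}),
    (forall l, f (g0 l) = x l) -> forall l, F x l = f (i (g1 l)).
Proof.
(* Writing [i (g1 l)] in the generators [g0] gives a formula that makes sense on all tuples,
   including those not induced by a map. *)
have [a aE] := choice (fun l => g0P (i (g1 l))).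
pose F (x : {ffun 'I_n0 -> vmod hN}) : {ffun 'I_n1 -> vmod hN} :=
  [ffun l => \sum_j a l j *: (x j : N) : vmod hN].
have lF : linear F.
  move=> b x y; apply/ffunP=> l; rewrite !ffunE.
  rewrite [X in _ = X + _](@scaler_sumr _ N b%:A) -big_split /=; apply: eq_bigr => j _.
  by rewrite !ffunE scalerDr scalar_comm.
exists (linfun (lin_of lF)) => x f fx l.
rewrite lfunE /= ffunE aE linear_sum; apply: eq_bigr => j _.
by rewrite linearZ /= fx.
Qed.

(** Extensibility makes restriction along [i] map Hom(P0, N) onto Hom(P1, N). By rank-nullity the
    dimensions differ by that of its kernel, which is zero exactly when [hom_vanish] holds. *)
Lemma homdim_restriction : extensible i N ->
  (hom_vanish i N -> homdim g1 hN = homdim g0 hN) /\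
  (~ hom_vanish i N -> (homdim g1 hN < homdim g0 hN)%N).
Proof.
move=> EN; have [F FE] := restriction_map.
have FW : (F @: hom_space g0 hN = hom_space g1 hN)%VS.
  apply/vspaceP => y; apply/memv_imgP/idP => [[x /hom_spaceP[f fx] ->]|/hom_spaceP[f fy]].
    by apply/hom_spaceP; exists (f \o i) => l; rewrite (FE x f).
  have [w wE] := EN f.
  exists [ffun l => w (g0 l) : vmod hN].
    by apply/hom_spaceP; exists w => l; rewrite ffunE.
  apply/ffunP=> l; rewrite (FE _ w) ?wE ?fy // => j; by rewrite ffunE.
have dimE := limg_ker_dim F (hom_space g0 hN); rewrite FW in dimE.
rewrite /homdim; split=> HN; rewrite -dimE.
  suff -> : (hom_space g0 hN :&: lker F = 0)%VS by rewrite dimv0.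
  apply/eqP; rewrite -subv0; apply/subvP => x; rewrite memv_cap memv_ker.
  move=> /andP[/hom_spaceP[f fx] /eqP Fx0]; rewrite memv0; apply/eqP/ffunP=> l.
  rewrite -fx [RHS]ffunE; apply: HN.
  apply: (generates_eq (f1 := f \o i) (f2 := \0) g1P) => j /=.
  by rewrite -(FE x) // Fx0 ffunE.
rewrite -[ltnLHS]add0n ltn_add2r lt0n dimv_eq0; apply/negP => /eqP K0.
apply: HN => w wi0.
apply: (generates_eq (f1 := w) (f2 := \0) g0P) => l /=.
pose x := [ffun l => w (g0 l) : vmod hN].
have xw j : w (g0 j) = x j by rewrite ffunE.
suff : x \in (hom_space g0 hN :&: lker F)%VS.
  by rewrite K0 memv0 => /eqP x0; rewrite xw x0 ffunE.
rewrite memv_cap memv_ker; apply/andP; split; first by apply/hom_spaceP; exists w.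
by apply/eqP/ffunP=> j; rewrite (FE x w xw) wi0 ffunE.
Qed.
End Restriction.

Lemma hom_span P n (g : 'I_n -> P) N : generates g -> findim N ->
  exists m (f : 'I_m -> {linear P -> N}), forall u : {linear P -> N},
  exists c : 'I_m -> k, forall x, u x = \sum_l (c l)%:A *: f l x.
Proof.
move=> gP hN; pose W := hom_space g hN; pose b := vbasis W.
have bW l : tnth b l \in W by rewrite vbasis_mem ?mem_tnth.
have [f fE] := choice (fun l => (hom_spaceP g (tnth b l)).1 (bW l)).
exists (\dim W), f => u.
pose x := [ffun l => u (g l) : vmod hN].
have xW : x \in W by apply/hom_spaceP; exists u => l; rewrite ffunE.
exists (fun l => coord b l x).
have lS : linear (fun y => \sum_l (coord b l x)%:A *: f l y).
  move=> a y z; rewrite scaler_sumr -big_split /=; apply: eq_bigr => l _.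
  by rewrite !linearP scalerDr scalar_comm.
apply: (generates_eq (f2 := lin_of lS) gP) => j /=.
have : x j = u (g j) by rewrite ffunE.
move=> <-; rewrite {1}(coord_vbasis xW) sum_ffunE; apply: eq_bigr => l _.
by rewrite ffunE fE (tnth_nth 0).
Qed.

(** * Closure properties of finite-dimensional modules *)

Lemma findim_generates N : findim N -> exists n (g : 'I_n -> N), generates g.
Proof.
move=> [n [g gP]]; exists n, g => x; have [c ->] := gP x.
by exists (fun l => (c l)%:A).
Qed.

Lemma generates_findim P n (g : 'I_n -> P) : generates g -> findim P.
Proof.
move=> gP; pose e := vbasis {:H}.
exists #|{: 'I_n * 'I_(\dim {:H})}|,
  (fun s => tnth e (enum_val s).2 *: g (enum_val s).1) => x.
have [c ->] := gP x.
exists (fun s => coord e (enum_val s).2 (c (enum_val s).1)).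
rewrite (sum_pair_enum (fun l s => (coord e s (c l))%:A *: (tnth e s *: g l))).
apply: eq_bigr => l _; rewrite {1}(coord_vbasis (memvf (c l))) scaler_suml.
by apply: eq_bigr => s _; rewrite scalerA -scalerAl mul1r (tnth_nth 0).
Qed.

Lemma findim_surj A B (p : {linear A -> B}) :
  (forall y, exists x, p x = y) -> findim A -> findim B.
Proof.
move=> p_surj [n [g gP]]; exists n, (p \o g) => y; have [x <-] := p_surj y.
have [c ->] := gP x; exists c; rewrite linear_sum; apply: eq_bigr => l _.
by rewrite linearZ.
Qed.

Lemma findim_inj A B (i : {linear A -> B}) : injective i -> findim B -> findim A.
Proof.
move=> i_inj hB.
have [W WP] : exists W : {vspace vmod hB}, forall y, y \in W <-> exists x, i x = y.
  apply: vspace_of_submod => [|a x y [u <-] [v <-]]; first by exists 0; rewrite linear0.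
  by exists (a%:A *: u + v); rewrite linearP.
have bW l : tnth (vbasis W) l \in W by rewrite vbasis_mem ?mem_tnth.
have [g gE] := choice (fun l => (WP _).1 (bW l)).
exists (\dim W), g => x.
have ixW : i x \in W by apply/WP; exists x.
exists (fun l => coord (vbasis W) l (i x)); apply: i_inj.
rewrite [LHS](coord_vbasis ixW) linear_sum; apply: eq_bigr => l _.
by rewrite linearZ /= gE (tnth_nth 0).
Qed.

Lemma findim_ses A B C (i : {linear A -> B}) (p : {linear B -> C}) :
  ses i p -> findim A -> findim C -> findim B.
Proof.
move=> [i_inj exp p_surj] [n [g gP]] [m [h hP]].
have [h' h'E] := choice (fun l => p_surj (h l)).
exists (n + m)%N, (fun s => match split s with inl l => i (g l) | inr l => h' l end) => x.
have [c cE] := hP (p x).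
have [|y yE] := (exp (x - \sum_l (c l)%:A *: h' l)).1.
  rewrite linearB linear_sum {1}cE; apply/eqP; rewrite subr_eq0; apply/eqP.
  by apply: eq_bigr => l _; rewrite linearZ /= h'E.
have [b bE] := gP y.
exists (fun s => match split s with inl l => b l | inr l => c l end).
rewrite big_split_ord /= -[LHS](subrK (\sum_l (c l)%:A *: h' l)) -yE bE linear_sum.
congr (_ + _); apply: eq_bigr => l _.
  by rewrite (unsplitK (inl l)) linearZ.
by rewrite (unsplitK (inr l)).
Qed.

Lemma findim_ffun A n : findim A -> findim {ffun 'I_n -> A}.
Proof.
move=> [m [g gP]].
exists #|{: 'I_n * 'I_m}|, (fun s => ffun_inj (enum_val s).1 (g (enum_val s).2)) => x.
have [c cE] := choice (fun l => gP (x l)).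
exists (fun s => c (enum_val s).1 (enum_val s).2).
rewrite (sum_pair_enum (fun l s => (c l s)%:A *: ffun_inj l (g s))).
rewrite [LHS]ffun_sum_inj; apply: eq_bigr => l _; rewrite cE linear_sum.
by apply: eq_bigr => s _; rewrite linearZ.
Qed.
End FiniteDimensional.

(** * The Euler form *)

Section AdditiveFunctions.
Variables (k : fieldType) (H : falgType k).
Implicit Types A B C M N P S T : lmodType H.
Hypothesis H_hereditary : hereditary H.

Definition additive_function (phi : forall N, findim N -> rat) : Prop :=
  forall A B C (i : {linear A -> B}) (p : {linear B -> C}) hA hB hC,
    ses i p -> phi B hB = phi A hA + phi C hC.

Lemma projective_regular : projective (H^o : lmodType H).
Proof. by apply: (H_hereditary (i := idfun)) => x y. Qed.

Lemma generates_regular : generates (fun _ : 'I_1 => 1 : H^o).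
Proof.
by move=> x; exists (fun _ => x); rewrite big_ord1 -[LHS]mulr1.
Qed.

(** By evaluation at 1 this is the dimension of [N] over [k]; as a Hom dimension it inherits
    additivity from [homdim_ses]. *)
Definition kdim N (hN : findim N) : nat := homdim (fun _ : 'I_1 => 1 : H^o) hN.

Lemma kdim_ses A B C (i : {linear A -> B}) (p : {linear B -> C})
    (hA : findim A) (hB : findim B) (hC : findim C) :
  ses i p -> kdim hB = (kdim hA + kdim hC)%N.
Proof. exact: homdim_ses generates_regular projective_regular. Qed.

Lemma kdim_eq0 N (hN : findim N) : kdim hN = 0%N -> zero_module N.
Proof.
move=> /eqP; rewrite dimv_eq0 => /eqP W0 x.
have lx : linear (fun h : H^o => h *: x) by move=> a u v; rewrite scalerDl scalerA.
have : [ffun=> x : vmod hN] \in hom_space (fun _ : 'I_1 => 1 : H^o) hN.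
  by apply/hom_spaceP; exists (lin_of lx) => l; rewrite ffunE /= scale1r.
by rewrite W0 memv0 => /eqP/ffunP/(_ ord0); rewrite !ffunE.
Qed.

Lemma additive_function_zero phi N (hN : findim N) :
  additive_function phi -> zero_module N -> phi N hN = 0.
Proof.
move=> phiD N0.
(* On a zero module two identity maps form a short exact sequence, so [phi N = phi N + phi N]. *)
have zz : ses (@idfun N) (@idfun N).
  split=> [x y //|x|z]; last by exists z.
  by split=> [_|_]; [exists x | exact: N0].
by have /eqP := phiD _ _ _ _ _ hN hN hN zz; rewrite -subr_eq0 opprD addrA subrr sub0r oppr_eq0 => /eqP.
Qed.

(** Induction on the dimension: a module neither zero nor simple has a proper nonzero submodule, and
    both pieces are smaller. *)
Lemma additive_function_eq0 phi : additive_function phi ->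
  (forall S (hS : findim S), simple_module S -> phi S hS = 0) ->
  forall N (hN : findim N), phi N hN = 0.
Proof.
move=> phiD phiS N hN; move: {2}(kdim hN).+1 (ltnSn (kdim hN)) => d.
elim: d N hN => // d IH N hN; rewrite ltnS => le_d.
have [N0|N_nz] := pselect (zero_module N); first exact: additive_function_zero.
have [Ns|N_ns] := pselect (simple_module N); first exact: phiS.
have [P [subP [[x [Px x0]] [y nPy]]]] : exists P : N -> Prop, is_submodule P /\
    ((exists x, P x /\ x <> 0) /\ (exists y, ~ P y)).
  apply: contrapT => noP; apply: N_ns; split=> // P subP.
  apply: contrapT => /not_orP[/existsNP[x /not_implyP[Px x0]] /existsNP[y nPy]].
  by apply: noP; exists P; split=> //; split; [exists x | exists y].
have [A [i [i_inj iP]]] := submodule_exists subP.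
have [C [p ip]] := ses_of_inj i_inj; have [_ exp p_surj] := ip.
have hA := findim_inj i_inj hN; have hC := findim_surj p_surj hN.
have dE := kdim_ses hA hN hC ip.
have A_gt0 : (0 < kdim hA)%N.
  rewrite lt0n; apply/eqP => /kdim_eq0 A0.
  by have [a ax] := (iP x).1 Px; apply: x0; rewrite -ax (A0 a) linear0.
have C_gt0 : (0 < kdim hC)%N.
  rewrite lt0n; apply/eqP => /kdim_eq0 C0; apply: nPy; apply/iP.
  by apply/exp; exact: C0.
have lt_A : (kdim hA < kdim hN)%N by rewrite dE -{1}(addn0 (kdim hA)) ltn_add2l.
have lt_C : (kdim hC < kdim hN)%N by rewrite dE -{1}(add0n (kdim hC)) ltn_add2r.
rewrite (phiD _ _ _ _ _ hA hN hC ip) (IH _ hA (leq_trans lt_A le_d)).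
by rewrite (IH _ hC (leq_trans lt_C le_d)) addr0.
Qed.

Lemma additive_function_iso phi M N (hM : findim M) (hN : findim N) :
  additive_function phi -> module_iso M N -> phi M hM = phi N hN.
Proof.
move=> phiD [f f_bij]; have [f_inj [g fK gK]] := (bij_inj f_bij, f_bij).
have [C [p fp]] := ses_of_inj f_inj; have [_ exp p_surj] := fp.
have hC := findim_surj p_surj hN.
rewrite (phiD _ _ _ _ _ hM hN hC fp) (additive_function_zero hC) ?addr0 // => z.
by have [x <-] := p_surj z; apply/exp; exists (g x).
Qed.

(** Any nonzero element generates a simple module, and [H] is finite-dimensional. *)
Lemma simple_findim S : simple_module S -> findim S.
Proof.
move=> [S_nz Ssub]; have [x x0] : exists x : S, x <> 0.
  by apply: contrapT => nox; apply: S_nz => x; apply: contrapT => x0; apply: nox; exists x.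
apply: (@generates_findim k H S 1 (fun=> x)) => y.
have [|Px|/(_ y)[h <-]] := Ssub (fun y => exists h : H, h *: x = y).
- split=> [|a u v [b <-] [c <-]]; first by exists 0; rewrite scale0r.
  by exists (a * b + c); rewrite scalerDl scalerA.
- by case: x0; apply: Px; exists 1; rewrite scale1r.
- by exists (fun=> h); rewrite big_ord1.
Qed.

Lemma left_kernel_exists (F : fieldType) m n (M : 'M[F]_(m, n)) :
  (n < m)%N -> exists c : 'rV[F]_m, c != 0 /\ c *m M = 0.
Proof.
move=> lt_nm; have : kermx M != 0.
  rewrite -mxrank_eq0 mxrank_ker -lt0n subn_gt0.
  exact: leq_ltn_trans (rank_leq_col M) lt_nm.
by move=> /rowV0Pn[c /sub_kermxP cM c0]; exists c.
Qed.

(** * Triangularity of the Euler form and vanishing of perpendicular modules *)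

Section Triangular.
Variable n : nat.
Hypothesis H_simples : number_of_simples H n.
Variables (E P1 P0 : 'I_n -> lmodType H) (i : forall s, {linear P1 s -> P0 s}).
Hypotheses (proj1 : forall s, projective (P1 s)) (proj0 : forall s, projective (P0 s)).
Hypotheses (fin1 : forall s, findim (P1 s)) (fin0 : forall s, findim (P0 s)).
Hypothesis finE : forall s, findim (E s).
Hypothesis perpE : forall s t : 'I_n, (s < t)%N -> perp (i t) (E s).
Hypotheses (extE : forall s, extensible (i s) (E s))
  (homE : forall s, ~ hom_vanish (i s) (E s)).

(* [phi s N] is the Euler form dim Hom(E s, N) - dim Ext^1(E s, N), computed as
   dim Hom(P0 s, N) - dim Hom(P1 s, N). *)
Lemma euler_form_exists : exists phi : 'I_n -> forall N, findim N -> rat,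
  [/\ forall s, additive_function (phi s),
      forall s N hN, perp (i s) N -> phi s N hN = 0
    & forall s, phi s (E s) (finE s) <> 0].
Proof.
have G1 s : {n1 : nat & {g : 'I_n1 -> P1 s | generates g}}.
  by have /cid[m /cid[g gP]] := findim_generates (fin1 s); exists m, g.
have G0 s : {n0 : nat & {g : 'I_n0 -> P0 s | generates g}}.
  by have /cid[m /cid[g gP]] := findim_generates (fin0 s); exists m, g.
pose g1 s := sval (projT2 (G1 s)); pose g0 s := sval (projT2 (G0 s)).
have g1P s : generates (g1 s) := svalP (projT2 (G1 s)).
have g0P s : generates (g0 s) := svalP (projT2 (G0 s)).
pose phi s N (hN : findim N) : rat := (homdim (g0 s) hN)%:R - (homdim (g1 s) hN)%:R.
exists phi; split=> [s A B C j p hA hB hC jp|s N hN [HN EN]|s].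
- rewrite /phi (homdim_ses hA hB hC (g1P s) (@proj1 s) jp).
  rewrite (homdim_ses hA hB hC (g0P s) (@proj0 s) jp) !natrD opprD.
  by rewrite addrACA.
- have [e _] := homdim_restriction (i := i s) (g1P s) (g0P s) hN EN.
  by rewrite /phi e // subrr.
- have [_ lt] := homdim_restriction (i := i s) (g1P s) (g0P s) (finE s) (@extE s).
  rewrite /phi => /eqP; rewrite subr_eq0 Num.Theory.eqr_nat => /eqP e.
  by have := lt (@homE s); rewrite e ltnn.
Qed.

Lemma perp_complete_zero N : findim N -> (forall s, perp (i s) N) -> zero_module N.
Proof.
have [phi [phiD phi0 phiE]] := euler_form_exists.
have [S [S_simple _ S_all]] := H_simples.
pose hS s := simple_findim (S_simple s).
pose dimq M (hM : findim M) : rat := (kdim hM)%:R.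
have dimD : additive_function dimq.
  by move=> A B C j p hA hB hC jp; rewrite /dimq (kdim_ses hA hB hC jp) natrD.
(* Index 0 carries the dimension, the others the Euler forms: [n + 1] functions on [n] simple
   modules, so a nontrivial relation [c] exists. *)
pose psi (s : 'I_n.+1) := if unlift ord0 s is Some t then phi t else dimq.
have psiD s : additive_function (psi s) by rewrite /psi; case: unlift.
have [c [c_nz cM]] := left_kernel_exists
  (\matrix_(s < n.+1, j < n) psi s (S j) (hS j)) (ltnSn n).
have sum0 M (hM : findim M) : \sum_s c 0 s * psi s M hM = 0.
  apply: (@additive_function_eq0 (fun M hM => \sum_s c 0 s * psi s M hM)).
    move=> A B C j p hA hB hC jp; rewrite -big_split /=; apply: eq_bigr => s _.
    by rewrite (psiD s _ _ _ _ _ hA hB hC jp) mulrDr.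
  move=> T hT /S_all[j Tj].
  have := congr1 (fun A : 'rV_n => A 0 j) cM; rewrite !mxE => e0; rewrite -[RHS]e0.
  apply: eq_bigr => s _; rewrite mxE; congr (_ * _).
  exact: additive_function_iso.
have {}sum0 M (hM : findim M) :
    c 0 ord0 * dimq M hM + \sum_t c 0 (lift ord0 t) * phi t M hM = 0.
  rewrite -[RHS](sum0 M hM) big_ord_recl /psi unlift_none; congr (_ + _).
  by apply: eq_bigr => t _; rewrite liftK.
(* Otherwise evaluating the relation at [E t] for increasing [t] kills every coefficient: earlier
   ones vanish by induction, later forms vanish on [E t] by [perpE], and [phi t] does not. *)
have c0_nz : c 0 ord0 != 0.
  apply/eqP => c00; case/eqP: c_nz; apply/rowP => s; rewrite [RHS]mxE.
  case: (unliftP ord0 s) => [t|] -> //.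
  move: {2}t.+1 (ltnSn t) => m; elim: m t => // m IH t; rewrite ltnS => le_tm.
  have := sum0 (E t) (finE t); rewrite c00 mul0r add0r (bigD1 t) //= big1.
    by rewrite addr0 => /eqP; rewrite mulf_eq0 => /orP[/eqP|/eqP/phiE].
  move=> u ut; case: (ltngtP u t) => [lt_ut|lt_tu|e].
  - by rewrite IH ?mul0r //; apply: leq_trans le_tm.
  - by rewrite phi0 ?mulr0 //; apply: perpE.
  - by rewrite (val_inj e) eqxx in ut.
move=> hN Nperp; apply: (@kdim_eq0 N hN); have := sum0 N hN.
rewrite big1 ?addr0 => [/eqP|t _]; last by rewrite phi0 ?mulr0.
by rewrite mulf_eq0 (negPf c0_nz) /= Num.Theory.pnatr_eq0 => /eqP.
Qed.
End Triangular.
End AdditiveFunctions.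

(** * Reflection in a perpendicular category *)

Section Reflection.
Variables (k : fieldType) (H : falgType k).
Implicit Types A B C D E I K M N P S T X Y Z : lmodType H.
Hypothesis H_hereditary : hereditary H.

Lemma findim_fg N : findim N -> finitely_generated N.
Proof. exact: findim_generates. Qed.

Lemma fg_findim N : finitely_generated N -> findim N.
Proof. by move=> [n [g gP]]; exact: generates_findim gP. Qed.

Lemma scalar_tuple P n (c : 'I_n -> k) :
  exists f : {linear P -> {ffun 'I_n -> P}}, forall x l, f x l = (c l)%:A *: x.
Proof.
have lf : linear (fun x => [ffun l => (c l)%:A *: x] : {ffun 'I_n -> P}).
  by move=> a x y; apply/ffunP=> l; rewrite !ffunE scalerDr scalar_comm.
by exists (lin_of lf) => x l; rewrite /= ffunE.
Qed.

(* Push out m copies of P1 -> P0 along a family of m maps P1 -> Y which spans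
   Hom(P1, Y), and hence Ext^1(E, Y). *)
Lemma universal_extension P1 P0 E (i : {linear P1 -> P0}) (p : {linear P0 -> E}) Y :
  presentation i p -> findim P1 -> findim Y -> extensible i E ->
  exists m X (j : {linear Y -> X}) (q : {linear X -> {ffun 'I_m -> E}}),
    ses j q /\ extensible i X.
Proof.
move=> [proj1 proj0 ip] fin1 finY EE; have [i_inj exp p_surj] := ip.
have [d [g gP]] := findim_generates fin1.
have [m [f fP]] := hom_span gP finY.
have [im imE] := ffun_pair (fun l : 'I_m => i \o ffun_proj l).
have [pm pmE] := ffun_pair (fun l : 'I_m => p \o ffun_proj l).
have imp : ses im pm.
  split=> [x y e|x|z].
  - apply/ffunP=> l; apply: i_inj.
    by have := congr1 (ffun_proj l) e; rewrite /ffun_proj !imE.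
  - split=> [px0|[y <-]]; last first.
      by apply/ffunP=> l; rewrite pmE /= /ffun_proj imE (ses_comp0 _ ip) ffunE.
    have exl l : exists y, i y = x l.
      by apply/exp; have := congr1 (ffun_proj l) px0; rewrite /ffun_proj pmE ffunE.
    have [y yE] := choice exl; exists [ffun l => y l].
    by apply/ffunP=> l; rewrite imE /= /ffun_proj ffunE yE.
  - have [x xE] := choice (fun l => p_surj (z l)); exists [ffun l => x l].
    by apply/ffunP=> l; rewrite pmE /= /ffun_proj ffunE xE.
have [F [FE _]] := ffun_copair f.
have [X [j [q [h [jq hi qh]]]]] := pushout F imp; have [j_inj exq q_surj] := jq.
exists m, X, j, q; split=> // u.
have [w wE] := extensible_ffun (n:=m) EE (q \o u); have [v vE] := proj0 _ _ q w q_surj.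
have [|u' u'E] := factor_inj j_inj (f := u \- (v \o i)).
  by move=> x; apply/exq; rewrite /= linearB vE wE subrr.
(* The residual map [u'] to [Y] is a [k]-combination of the [f l], that is, [F] after a scalar
   tuple; the same tuple on [P0], followed by [h], extends it. *)
have [c cE] := fP u'; have [a aE] := scalar_tuple P0 c.
exists (v \+ (h \o a)) => x /=.
have [b bE] := scalar_tuple P1 c.
have -> : a (i x) = im (b x).
  by apply/ffunP=> l; rewrite aE imE /= /ffun_proj bE linearZ.
rewrite hi FE.
have -> : \sum_l f l (b x l) = u' x.
  by rewrite cE; apply: eq_bigr => l _; rewrite bE linearZ.
by rewrite u'E /= addrC subrK.
Qed.

(** The summands carry a family spanning Hom(E, X) over [k], so the image of [f] is the trace of [E]
    in [X]. *)
Lemma universal_map E X : findim E -> findim X ->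
  exists r (f : {linear {ffun 'I_r -> E} -> X}),
    forall h : {linear E -> X},
    exists t : {linear E -> {ffun 'I_r -> E}}, forall x, h x = f (t x).
Proof.
move=> finE finX; have [d [g gP]] := findim_generates finE.
have [r [f fP]] := hom_span gP finX.
have [F [FE _]] := ffun_copair f.
exists r, F => h; have [c cE] := fP h; have [t tE] := scalar_tuple E c.
exists t => x; rewrite FE cE; apply: eq_bigr => l _.
by rewrite tE linearZ.
Qed.

Variables (J : Type) (E P1 P0 : J -> lmodType H).
Variables (i : forall s, {linear P1 s -> P0 s}) (p : forall s, {linear P0 s -> E s}).
Hypotheses (pres : forall s, presentation (i s) (p s)).
Hypotheses (fin1 : forall s, findim (P1 s)) (finE : forall s, findim (E s)).

Definition perp_to (L : J -> Prop) N : Prop := forall t, L t -> perp (i t) N.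

(* The third clause says that [Z] is projective in the perpendicular category;
   it is what lets a reflection be reflected again in [reflection_step]. *)
Definition reflection (L D : J -> Prop) Y Z (f : {linear Y -> Z}) : Prop :=
  [/\ findim Z, perp_to L Z,
      forall N, perp_to L N -> ext_vanish Z N,
      forall t, D t -> acyclic (i t) f
    & forall N (h : {linear Y -> N}), perp_to L N ->
        exists h' : {linear Z -> N}, forall x, h' (f x) = h x].

(* Let [X] be a universal extension of [Y] by copies of [E s], and [I] the trace
   of [E s] in [X], a quotient of some power of [E s] by a kernel [K].  Then
   Ext^1(X, K) = 0, so Ext^1(I, K) = 0 by heredity: [I] is a direct summand of
   that power, and [X / I] is the reflection. *)
Lemma reflection_step (L D : J -> Prop) s Y : extensible (i s) (E s) ->
  perp_to L (E s) -> perp_to D (E s) ->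
  findim Y -> perp_to L Y -> (forall N, perp_to L N -> ext_vanish Y N) ->
  exists (Z : lmodType H) (f : {linear Y -> Z}), reflection (fun t => L t \/ t = s) D f.
Proof.
move=> Es_rigid L_E D_E finY L_Y extY; have [proj1 proj0 ip] := pres s.
have [m [X [j [q [jq extX]]]]] :=
  universal_extension (pres s) (@fin1 s) finY Es_rigid.
have [j_inj exq q_surj] := jq.
have finX : findim X by apply: findim_ses jq finY _; apply: findim_ffun.
have L_X : perp_to L X.
  move=> t Lt; have [HY EY] := L_Y t Lt; have [HE EE] := perp_ffun m (L_E t Lt).
  have [_ proj0t _] := pres t.
  by split; [exact: hom_vanish_ext jq HY HE | exact: extensible_ext proj0t jq EY EE].
have ext_X N : perp_to L N -> extensible (i s) N -> ext_vanish X N.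
  move=> L_N EN; apply: ext_vanish_mid jq (extY _ L_N) _.
  by apply: ext_vanish_ffun; apply/(extensible_ext_vanish N (pres s)).
have [r [f fP]] := universal_map (@finE s) finX.
have [I [q1 [j1 [q1_surj j1_inj fE]]]] := image_factor f.
have fP0 (v : {linear P0 s -> X}) : (forall x, v (i s x) = 0) ->
    exists t : {linear E s -> {ffun 'I_r -> E s}}, forall x, v x = f (t (p s x)).
  move=> vi0; have [_ exp p_surj] := ip.
  have [|h hE] := factor_surj p_surj (f := v).
    by move=> x /exp[y <-].
  by have [t tE] := fP h; exists t => x; rewrite -tE hE.
have [K [k0 kq]] := ses_of_surj q1_surj; have [k_inj exq1 _] := kq.
have L_K : perp_to L K.
  move=> t Lt; have [HE EE] := perp_ffun r (L_E t Lt).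
  split; first exact: hom_vanish_sub k_inj HE.
  (* Hom(E t, X) = 0 and [I] embeds in [X], so the map to [I] is already zero and the zero lift
     serves. *)
  apply: (extensible_ker k_inj exq1 EE) => w qwi0; exists \0; split=> // x.
  rewrite linear0; apply/esym; have [HX _] := L_X t Lt.
  exact: (hom_vanish_sub j1_inj HX (w := q1 \o w)).
(* A map from [E s] to [I], seen in [X], factors through the universal map, so it lifts to the power
   of [E s]. *)
have ext_K : extensible (i s) K.
  apply: (extensible_ker k_inj exq1 (extensible_ffun (n:=r) Es_rigid)) => w qwi0.
  have [|t tE] := fP0 (j1 \o q1 \o w); first by move=> x /=; rewrite qwi0 linear0.
  exists (t \o p s); split=> x /=; first by rewrite (ses_comp0 _ ip) linear0.
  by apply: j1_inj; rewrite fE -tE.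
have [d [c c_surj]] := fg_free_cover (findim_fg finX).
have ext_IK : ext_vanish I K.
  apply: (ext_vanish_sub _ c_surj j1_inj (ext_X _ L_K ext_K)) => Q h.
  exact: hereditary_free.
have [sec secE] := ext_IK _ _ _ kq.
have perp_I t : perp (i t) (E s) -> perp (i t) I.
  by move=> /(perp_ffun r); apply: perp_retract secE.
have ext_I : extensible (i s) I.
  exact: extensible_retract secE (extensible_ffun (n:=r) Es_rigid).
have [Z [pi j1pi]] := ses_of_inj j1_inj; have [_ expi pi_surj] := j1pi.
exists Z, (pi \o j); split.
- exact: findim_surj pi_surj finX.
- move=> t [Lt|->]; last first.
    split; last exact: extensible_surj proj1 pi_surj extX.
    (* Every map from [E s] to [X] lands in the trace [I], and Ext^1(E s, I) = 0, so Hom(E s, Z) =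
       0. *)
    apply: (hom_vanish_coker proj1 proj0 pi_surj expi ext_I) => v /fP0[t' tE].
    by exists (q1 \o t' \o p s) => x; rewrite /= fE.
  have [proj1t proj0t _] := pres t; have [HX EX] := L_X t Lt.
  split; last exact: extensible_surj proj1t pi_surj EX.
  apply: (hom_vanish_coker proj1t proj0t pi_surj expi (perp_I t (L_E t Lt)).2).
  by move=> v vi0; exists \0 => x; rewrite HX //= linear0.
- move=> N L_N; have [HN EN] := L_N s (or_intror erefl).
  apply: (ext_vanish_coker j1pi).
    move=> h x; have [y <-] := q1_surj x.
    have HE := (hom_vanish_zero N ip).1 HN.
    exact: (hom_zero_ffun HE (h \o q1)).
  by apply: ext_X EN => t Lt; apply: L_N; left.
- move=> t Dt; have [proj1t proj0t _] := pres t; have pE := D_E t Dt.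
  (* The cokernel of [j] is a power of [E s] and the kernel of [pi] is [I]; both are perpendicular
     to [E t]. *)
  apply: acyclic_comp.
    by have [HE EE] := perp_ffun m pE; apply: acyclic_inj jq HE EE.
  by have [HI EI] := perp_I t pE; apply: acyclic_surj j1pi HI EI.
(* [h] extends along [j] since Ext^1(E s, N) = 0, and the extension vanishes on [I] since Hom(E s,
   N) = 0. *)
- move=> N h L_N; have [HN EN] := L_N s (or_intror erefl).
  have [|h1 h1E] := ext_extend h jq (N := N).
    by apply: ext_vanish_ffun; apply/(extensible_ext_vanish N (pres s)).
  have [|h2 h2E] := factor_surj pi_surj (f := h1).
    move=> x /expi[y <-]; have [z <-] := q1_surj y.
    have HE := (hom_vanish_zero N ip).1 HN.
    exact: (hom_zero_ffun HE (h1 \o j1 \o q1)).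
  by exists h2 => x; rewrite /= h2E h1E.
Qed.

Lemma reflection_comp (L L' D : J -> Prop) X Y Z
    (f : {linear X -> Y}) (g : {linear Y -> Z}) :
  (forall t, L t -> L' t) -> reflection L D f -> reflection L' D g ->
  reflection L' D (g \o f).
Proof.
move=> LL' [_ _ _ af uf] [fZ pZ eZ ag ug]; split=> // [t Dt|N h pN].
  by apply: acyclic_comp; [apply: af | apply: ag].
have [t Lt|h1 h1E] := uf N h; first by apply: pN; apply: LL'.
by have [h2 h2E] := ug N h1 pN; exists h2 => x; rewrite /= h2E h1E.
Qed.

Lemma reflection_id (L D : J -> Prop) Y : findim Y ->
  (forall t, ~ L t) -> (forall N, ext_vanish Y N) -> reflection L D (@idfun Y).
Proof.
move=> finY L0 eY; split=> // [t /L0 //|t _|N h _]; first exact: acyclic_id.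
by exists h.
Qed.
End Reflection.

(** * Reflection with respect to a subfamily of the sequence *)

Section ReflectionSequence.
Variables (k : fieldType) (H : falgType k).
Hypothesis H_hereditary : hereditary H.
Variables (n : nat) (E P1 P0 : 'I_n -> lmodType H).
Variables (i : forall s, {linear P1 s -> P0 s}) (p : forall s, {linear P0 s -> E s}).
Hypotheses (pres : forall s, presentation (i s) (p s)).
Hypotheses (fin1 : forall s, findim (P1 s)) (finE : forall s, findim (E s)).
Hypothesis perpE : forall s t : 'I_n, (s < t)%N -> perp (i t) (E s).
Hypothesis extE : forall s, extensible (i s) (E s).

(** The members of [L] are treated by decreasing index: by [perpE] each [E s] is then perpendicular
    to those treated before, as [reflection_step] demands. *)
Lemma reflection_exists (L D : 'I_n -> Prop) (Y : lmodType H) :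
  (forall s t, L s -> D t -> perp (i t) (E s)) ->
  findim Y -> projective Y ->
  exists (Z : lmodType H) (f : {linear Y -> Z}), reflection i L D f.
Proof.
move=> LD finY projY.
have extY N : ext_vanish Y N.
  by move=> X j q [_ _ q_surj]; exact: (projY _ _ q idfun).
(* [n <= t + m] selects the last [m] indices: [m = 0] is the identity of [Y], and [m = n] is the
   claim. *)
suff main m : exists (Z : lmodType H) (f : {linear Y -> Z}),
    reflection i (fun t : 'I_n => L t /\ (n <= t + m)%N) D f.
  have [Z [f [fZ pZ eZ af uf]]] := main n; exists Z, f.
  have LL t : L t -> L t /\ (n <= t + n)%N by split; rewrite ?leq_addl.
  split=> // [t /LL/pZ //|N pN|N h pN]; first by apply: eZ => t [/pN].
  by apply: uf => t [/pN].
elim: m => [|m [Z [f rf]]].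
  exists Y, idfun; apply: reflection_id => // t [_].
  by rewrite addn0 leqNgt ltn_ord.
(* When no [s] in [L] satisfies [s + m.+1 = n], stages [m] and [m.+1] impose the same conditions and
   the map is kept. *)
have same : (forall t, L t /\ (n <= t + m.+1)%N -> L t /\ (n <= t + m)%N) ->
  exists (Z : lmodType H) (f : {linear Y -> Z}),
    reflection i (fun t : 'I_n => L t /\ (n <= t + m.+1)%N) D f.
  move=> LL; exists Z, f; move: rf => [fZ pZ eZ af uf].
  have LL' t : L t /\ (n <= t + m)%N -> L t /\ (n <= t + m.+1)%N.
    by move=> [Lt le]; split=> //; rewrite addnS leqW.
  split=> // [t /LL/pZ //|N pN|N h pN]; first by apply: eZ => t /LL'/pN.
  by apply: uf => t /LL'/pN.
have [[s [Ls se]]|no_s] := pselect (exists s : 'I_n, L s /\ (s + m.+1 = n)%N); last first.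
  apply: same => t [Lt le]; split=> //; move: le; rewrite leq_eqVlt addnS ltnS.
  by case/orP=> // /eqP e; case: no_s; exists t; rewrite addnS.
have [Z' [g rg]] : exists (Z' : lmodType H) (g : {linear Z -> Z'}),
    reflection i (fun t => (L t /\ (n <= t + m)%N) \/ t = s) D g.
  case: rf => fZ pZ eZ _ _.
  apply: (reflection_step H_hereditary pres fin1 finE) => // t.
    move=> [Lt le]; apply: perpE; rewrite -(ltn_add2r m); apply: leq_trans le.
    by rewrite -addnS se.
  exact: LD.
exists Z', (g \o f).
have eqL t : (L t /\ (n <= t + m)%N) \/ t = s <-> L t /\ (n <= t + m.+1)%N.
  split=> [[[Lt le]|->]|[Lt]]; first by rewrite addnS leqW.
    by rewrite se.
  rewrite leq_eqVlt => /orP[/eqP e|]; last by rewrite addnS ltnS; left.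
  by right; apply: val_inj; apply/eqP; rewrite -(eqn_add2r m.+1) -e se.
have := reflection_comp (fun t => @or_introl _ (t = s)) rf rg.
move=> [fZ' pZ' eZ' af' uf']; split=> // [t /eqL/pZ' //|N pN|N h pN].
  by apply: eZ' => t /eqL/pN.
by apply: uf' => t /eqL/pN.
Qed.
End ReflectionSequence.

(** * Blocks *)

Section CentralIdempotent.
Variables (k : fieldType) (H : falgType k).

Lemma idempotent_aspace (e : H) : e != 0 -> e * e = e -> (forall h, e * h = h * e) ->
  exists A : {aspace H}, algid A = e /\ forall x, x \in A <-> x * e = x.
Proof.
move=> e0 ee ec.
have [U UP] : exists U : {vspace H}, forall x, x \in U <-> x * e = x.
  apply: vspace_of_submod => [|a x y xe ye]; first by rewrite mul0r.
  by rewrite mulrDl -scalerAl xe ye.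
have Ue : e \in U by apply/UP.
have aU : is_aspace U.
  apply/andP; split.
    apply/has_algidP; exists e; split=> // u /UP ue.
    by rewrite ec ue.
  apply/prodvP => u v _ /UP ve; apply/UP.
  by rewrite -mulrA ve.
exists (ASpace aU); split=> //; set A := ASpace aU.
have /UP <- : algid A \in U := memv_algid A.
by rewrite (@algidl _ _ A).
Qed.

(** Any other [e] would decompose [H] by sending [h] to [(h * e, h * (1 - e))], with addition as the
    inverse map. *)
Lemma connected_idempotent (e : H) : connected_algebra H ->
  e * e = e -> (forall h, e * h = h * e) -> e = 0 \/ e = 1.
Proof.
move=> H_conn ee ec; apply: contrapT => /not_orP[/eqP e0 e1].
pose e' : H := 1 - e.
have e'0 : e' != 0 by rewrite subr_eq0 eq_sym; apply/eqP.
have e'e : e' * e = 0 by rewrite mulrBl mul1r ee subrr.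
have ee' : e * e' = 0 by rewrite ec.
have e'e' : e' * e' = e' by rewrite {2}/e' mulrBr mulr1 e'e subr0.
have e'c h : e' * h = h * e' by rewrite mulrBl mulrBr mul1r mulr1 ec.
have [A [Ae AP]] := idempotent_aspace e0 ee ec.
have [B [Be BP]] := idempotent_aspace e'0 e'e' e'c.
have inA x : x * e \in A by apply/AP; rewrite -mulrA ee.
have inB x : x * e' \in B by apply/BP; rewrite -mulrA e'e'.
pose f (x : H) : (subvs_of A * subvs_of B)%type := (Subvs (inA x), Subvs (inB x)).
have lf : linear f.
  by move=> a x y; congr pair; apply: val_inj; rewrite /= mulrDl -scalerAl.
have idemM (c x y : H) : c * c = c -> (forall h, c * h = h * c) ->
    x * y * c = x * c * (y * c).
  by move=> cc cc'; rewrite -[RHS]mulrA cc' -[y * c * c]mulrA cc mulrA.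
have mf : monoid_morphism f.
  split=> [|x y]; congr pair; apply: val_inj; rewrite /= ?mul1r ?Ae ?Be //.
    exact: idemM.
  exact: idemM.
pose F : {lrmorphism H -> (subvs_of A * subvs_of B)%type} :=
  HB.pack f (GRing.isLinear.Build k H _ _ f lf)
    (GRing.isMonoidMorphism.Build H _ f mf).
apply: H_conn; exists (subvs_of A), (subvs_of B), F.
exists (fun u => vsval u.1 + vsval u.2) => [x|[u v]] /=.
  by rewrite -mulrDr addrC subrK mulr1.
have /AP ue := subvsP u; have /BP ve := subvsP v.
congr pair; apply: val_inj; rewrite /= mulrDl.
  by rewrite ue -ve -mulrA e'e mulr0 addr0.
by rewrite ve -ue -mulrA ee' mulr0 add0r.
Qed.
End CentralIdempotent.

Section Orthogonal.
Variables (k : fieldType) (H : falgType k).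
Hypothesis H_hereditary : hereditary H.
Implicit Types A B C E I K M N P S T X Y Z : lmodType H.

(** Two out of three: with [g] a projection, this makes a map into a product acyclic as soon as the
    projection and the matching component are. *)
Lemma acyclic_cancel P1 P0 (i : {linear P1 -> P0}) X Y Z
    (f : {linear X -> Y}) (g : {linear Y -> Z}) :
  acyclic i g -> acyclic i (g \o f) -> acyclic i f.
Proof.
move=> [ga gb _] [ha hb hc]; split=> [w wi0 fw0|u v uv|z].
- by apply: ha => // x /=; rewrite fw0 linear0.
- have [|w [wi gfw]] := hb u (g \o v); first by move=> x /=; rewrite uv.
  exists w; split=> // x; apply/eqP; rewrite -subr_eq0; apply/eqP.
  apply: (ga ((f \o w) \- v)) => y /=; first by rewrite wi uv subrr.
  by rewrite linearB [g (f _)]gfw subrr.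
- have [u [v uv]] := hc (g \o z).
  have [|w [wi gw]] := gb (z \- (f \o u)) v.
    by move=> x; rewrite /= linearB [g (z x)]uv /= addrC addKr.
  by exists u, w => x; rewrite wi /= addrC subrK.
Qed.

Lemma acyclic_eq P1 P0 (i : {linear P1 -> P0}) X Y (f g : {linear X -> Y}) :
  f =1 g -> acyclic i f -> acyclic i g.
Proof.
move=> fg [fa fb fc]; split=> [w wi0 gw0|u v uv|z].
- by apply: fa => // x; rewrite fg.
- have [|w [wi fw]] := fb u v; first by move=> x; rewrite fg.
  by exists w; split=> // x; rewrite -fg.
- by have [u [v uv]] := fc z; exists u, v => x; rewrite -fg.
Qed.

Lemma linear_pair_maps A B : exists (i1 : {linear A -> (A * B)%type})
    (i2 : {linear B -> (A * B)%type}) (p1 : {linear (A * B)%type -> A})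
    (p2 : {linear (A * B)%type -> B}),
  [/\ ses i2 p1, ses i1 p2, (p1 =1 fst) /\ (p2 =1 snd),
      forall x, i1 x = (x, 0) & forall x, i2 x = (0, x)].
Proof.
have l1 : linear (fun x : A => (x, 0 : B)).
  by move=> a x y; congr pair; rewrite /= scaler0 addr0.
have l2 : linear (fun x : B => (0 : A, x)).
  by move=> a x y; congr pair; rewrite /= scaler0 addr0.
have m1 : linear (fun x : (A * B)%type => x.1) by [].
have m2 : linear (fun x : (A * B)%type => x.2) by [].
exists (lin_of l1), (lin_of l2), (lin_of m1), (lin_of m2); split=> //.
- split=> [x y [] //|[x y]|x] /=; last by exists (x, 0).
  by split=> [->|[z [<-]] //]; exists y.
- split=> [x y [] //|[x y]|x] /=; last by exists (0, x).
  by split=> [->|[z [_ <-]] //]; exists x.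
Qed.

Lemma linear_pair X A B (f1 : {linear X -> A}) (f2 : {linear X -> B}) :
  exists f : {linear X -> (A * B)%type}, forall x, f x = (f1 x, f2 x).
Proof.
have lf : linear (fun x => (f1 x, f2 x)) by move=> a x y; rewrite !linearP.
by exists (lin_of lf).
Qed.

Lemma projective_free n : projective ({ffun 'I_n -> H^o} : lmodType H).
Proof. by apply: (hereditary_free H_hereditary (h := idfun)) => x y. Qed.

Lemma findim_free n : findim ({ffun 'I_n -> H^o} : lmodType H).
Proof. exact: findim_ffun (generates_findim (@generates_regular k H)). Qed.

(** The kernel of a free cover is projective by heredity. The sigma types allow the data to be
    projected out as functions of the index. *)
Lemma presentation_exists M : finitely_generated M ->
  {P1 : lmodType H & {P0 : lmodType H &
    {i : {linear P1 -> P0} & {p : {linear P0 -> M} |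
      presentation i p /\ findim P1 /\ findim P0}}}}.
Proof.
move=> /fg_free_cover/cid[n /cid[p p_surj]].
have /cid[K /cid[i ip]] := ses_of_surj p_surj; have [i_inj _ _] := ip.
exists K, {ffun 'I_n -> H^o}, i, p; split; last first.
  by split; [apply: findim_inj i_inj _ |]; apply: findim_free.
split=> //; first exact: (hereditary_free H_hereditary i_inj).
exact: projective_free.
Qed.

Lemma projective_free_retract P : findim P -> projective P ->
  exists n (s : {linear P -> {ffun 'I_n -> H^o}}) (r : {linear {ffun 'I_n -> H^o} -> P}),
    cancel s r.
Proof.
move=> /findim_fg/fg_free_cover[n [r r_surj]] projP.
by have [s sE] := projP _ _ r idfun r_surj; exists n, s, r.
Qed.

(* Ext^1(E, P1) = 0 since [P1] is a summand of a free module, so the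
   presentation splits and [E] embeds into [P0]; but Hom(E, P0) = 0. *)
Lemma perp_regular_zero P1 P0 E (i : {linear P1 -> P0}) (p : {linear P0 -> E}) :
  presentation i p -> findim P1 -> findim P0 -> perp i H^o -> zero_module E.
Proof.
move=> [proj1 proj0 ip] fin1 fin0 perpH; have [_ exp p_surj] := ip.
have [n [s [r sK]]] := projective_free_retract fin1 proj1.
have [_ E1] := perp_retract sK (perp_ffun n perpH).
have [n' [s' [r' sK']]] := projective_free_retract fin0 proj0.
have [H0 _] := perp_retract sK' (perp_ffun n' perpH).
have [w wE] := E1 idfun.
have wi x : x = i (w x).
  apply/eqP; rewrite -subr_eq0; apply/eqP.
  by apply: (H0 (idfun \- (i \o w))) => y /=; rewrite wE subrr.
by move=> z; have [x <-] := p_surj z; rewrite (wi x) (ses_comp0 _ ip).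
Qed.

(** * The block decomposition of the regular module *)

Section Blocks.
Variable n : nat.
Hypothesis H_simples : number_of_simples H n.
Variables (E P1 P0 : 'I_n -> lmodType H).
Variables (i : forall s, {linear P1 s -> P0 s}) (p : forall s, {linear P0 s -> E s}).
Hypotheses (pres : forall s, presentation (i s) (p s)).
Hypotheses (fin1 : forall s, findim (P1 s)) (fin0 : forall s, findim (P0 s)).
Hypothesis finE : forall s, findim (E s).
Hypothesis perpE : forall s t : 'I_n, (s < t)%N -> perp (i t) (E s).
Hypotheses (extE : forall s, extensible (i s) (E s))
  (homE : forall s, ~ hom_vanish (i s) (E s)).

Let proj1 s : projective (P1 s). Proof. by have [] := pres s. Qed.
Let proj0 s : projective (P0 s). Proof. by have [] := pres s. Qed.

Lemma acyclic_bijective X Y (f : {linear X -> Y}) : findim X -> findim Y ->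
  (forall s, acyclic (i s) f) -> injective f /\ forall y, exists x, f x = y.
Proof.
move=> finX finY f_ac.
have zero := perp_complete_zero H_hereditary H_simples proj1 proj0 fin1 fin0
  finE perpE extE homE.
have [K [j [j_inj jP]]] := submodule_exists (linear_submod_ker f).
have K0 : zero_module K.
  by apply: zero (findim_inj j_inj finX) _ => s; apply: acyclic_ker j_inj jP _.
have [C [q [q_surj qP]]] := quotient_exists (linear_submod_img f).
have C0 : zero_module C.
  apply: zero (findim_surj q_surj finY) _ => s.
  exact: acyclic_coker q_surj qP _.
split=> [x y e|y]; last exact/qP/C0.
apply/eqP; rewrite -subr_eq0; apply/eqP.
have [|z <-] := (jP (x - y)).1; first by rewrite linearB e subrr.
by rewrite (K0 z) linear0.
Qed.

Variable L : 'I_n -> Prop.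
Hypothesis orthogonal : forall s t, L s -> ~ L t ->
  perp (i t) (E s) /\ perp (i s) (E t).
Hypothesis H_connected : connected_algebra H.

Lemma connected_blocks : (forall s, L s) \/ (forall s, ~ L s).
Proof.
pose R := (H^o : lmodType H).
have finR : findim R := generates_findim (@generates_regular k H).
have projR : projective R := projective_regular H_hereditary.
have [Z1 [f1 [fin_1 perp1 _ ac1 uni1]]] : exists Z (f : {linear R -> Z}),
    reflection i L (fun t => ~ L t) f.
  by apply: (reflection_exists H_hereditary pres fin1 finE perpE extE _ finR projR) => s t Ls /(orthogonal Ls)[].
have [Z2 [f2 [fin_2 perp2 _ ac2 uni2]]] : exists Z (f : {linear R -> Z}),
    reflection i (fun t => ~ L t) L f.
  by apply: (reflection_exists H_hereditary pres fin1 finE perpE extE _ finR projR) => s t nLs Lt;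
     have [] := orthogonal Lt nLs.
have [f fE] := linear_pair f1 f2.
have [i1 [i2 [p1 [p2 [ip1 ip2 [p1E p2E] i1E i2E]]]]] := linear_pair_maps Z1 Z2.
have fin12 : findim (Z1 * Z2)%type by apply: findim_ses ip1 _ _.
(* For [s] in [L] the kernel [Z1] of [p2] is perpendicular to [E s], so [p2] and [f2], which is
   [p2 \o f], are acyclic, and [p2] cancels. Otherwise the roles are swapped. *)
have ac_f s : acyclic (i s) f.
  have [Ls|nLs] := pselect (L s).
    have [Hs Es] := perp1 s Ls.
    apply: acyclic_cancel (acyclic_surj (@proj1 s) (@proj0 s) ip2 Hs Es) _.
    by apply: acyclic_eq (ac2 s Ls) => x /=; rewrite p2E fE.
  have [Hs Es] := perp2 s nLs.
  apply: acyclic_cancel (acyclic_surj (@proj1 s) (@proj0 s) ip1 Hs Es) _.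
  by apply: acyclic_eq (ac1 s nLs) => x /=; rewrite p1E fE.
have [f_inj f_surj] := acyclic_bijective finR fin12 ac_f.
have f1_surj z : exists x, f1 x = z.
  by have [x] := f_surj (z, 0); rewrite fE => -[<- _]; exists x.
have f2_surj z : exists x, f2 x = z.
  by have [x] := f_surj (0, z); rewrite fE => -[_ <-]; exists x.
(* [g \o f1] factors through [f2], which kills a preimage of [(z, 0)] under [f]. For [N = Z2] this
   gives Hom(Z1, Z2) = 0. *)
have hom12 N (g : {linear Z1 -> N}) : perp_to i (fun t => ~ L t) N -> forall z, g z = 0.
  move=> pN z; have [h hE] := uni2 N (g \o f1) pN.
  have [x] := f_surj (z, 0); rewrite fE => -[<- f2x].
  by rewrite -[LHS]hE f2x linear0.
have hom21 N (g : {linear Z2 -> N}) : perp_to i L N -> forall z, g z = 0.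
  move=> pN z; have [h hE] := uni1 N (g \o f2) pN.
  have [x] := f_surj (0, z); rewrite fE => -[f1x <-].
  by rewrite -[LHS]hE f1x linear0.
have f_eq x y : f1 x = f1 y -> f2 x = f2 y -> x = y.
  by move=> e1 e2; apply: f_inj; rewrite !fE e1 e2.
have mulr_lin (h : H) : linear (fun x : R => (x : H) * h : R).
  by move=> a x y; rewrite mulrDl -mulrA.
(* The kernel of [f2] is the copy [i'] of [Z1] in [H]. Right multiplication by [h] is left linear,
   so followed by [f2] it is a map from [Z1] to [Z2], hence zero: the kernel is a two-sided
   ideal. *)
have ideal1 (x h : H) : f2 x = 0 -> f2 (x * h) = 0.
  have [i' i'E] := factor_inj f_inj (fun z => f_surj (i1 z)).
  move=> f2x; have <- : i' (f1 x) = x by apply: f_inj; rewrite i'E i1E fE f2x.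
  exact: (hom12 _ (f2 \o lin_of (mulr_lin h) \o i')).
have ideal2 (x h : H) : f1 x = 0 -> f1 (x * h) = 0.
  have [i' i'E] := factor_inj f_inj (fun z => f_surj (i2 z)).
  move=> f1x; have <- : i' (f2 x) = x by apply: f_inj; rewrite i'E i2E fE f1x.
  exact: (hom21 _ (f1 \o lin_of (mulr_lin h) \o i')).
(* [e] is the component of 1 in the copy of [Z1]. *)
have [e] := f_surj (f1 1, 0); rewrite fE => -[e1 e2].
have f1M (h x : H) : f1 (h * x) = h *: f1 x by rewrite -linearZ.
have f2M (h x : H) : f2 (h * x) = h *: f2 x by rewrite -linearZ.
have f1e h : f1 (h * e) = f1 h by rewrite f1M e1 -f1M mulr1.
have f2e h : f2 (h * e) = 0 by rewrite f2M e2 scaler0.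
have f2eh h : f2 (e * h) = 0 by exact: ideal1.
have f1eh h : f1 (e * h) = f1 h.
  apply/eqP; rewrite -subr_eq0 -linearB -opprB linearN oppr_eq0.
  have -> : h - e * h = (1 - e) * h by rewrite mulrBl mul1r.
  by apply/eqP/ideal2; rewrite linearB e1 subrr.
have ee : e * e = e by apply: f_eq; rewrite ?f1e ?f2e.
have ec h : e * h = h * e by apply: f_eq; rewrite ?f1e ?f1eh ?f2e ?f2eh.
have E_nz s : ~ zero_module (E s).
  by move=> E0; apply: (@homE s) => w _ x; exact: E0.
have [e0|e1'] := connected_idempotent H_connected ee ec.
(* Here [f1 = 0], so [f2] identifies the regular module with [Z2], which is perpendicular to every
   [E s] outside [L]. *)
- left=> s; apply: contrapT => nLs; apply: (E_nz s).
  apply: (perp_regular_zero (pres s) (fin1 s) (fin0 s)).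
  have f1_0 x : f1 x = 0 by rewrite -f1e e0 mulr0 linear0.
  have f2_inj : injective f2 by move=> x y; apply: f_eq; rewrite !f1_0.
  have [g gE] := factor_inj f2_inj (f := idfun) f2_surj.
  by apply: (perp_retract (s := f2) (r := g)) (perp2 s nLs) => x; apply: f2_inj; rewrite gE.
- right=> s Ls; apply: (E_nz s).
  apply: (perp_regular_zero (pres s) (fin1 s) (fin0 s)).
  have f2_0 x : f2 x = 0 by rewrite -[x]mulr1 -e1' f2e.
  have f1_inj : injective f1 by move=> x y ?; apply: f_eq; rewrite ?f2_0.
  have [g gE] := factor_inj f1_inj (f := idfun) f1_surj.
  by apply: (perp_retract (s := f1) (r := g)) (perp1 s Ls) => x; apply: f1_inj; rewrite gE.
Qed.
End Blocks.
End Orthogonal.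

Theorem theorem1p5 (k : fieldType) (H : falgType k) (n : nat)
    (E : 'I_n -> lmodType H) (H_connected : connected_algebra H)
    (H_hereditary : hereditary H) (H_simples : number_of_simples H n)
    (E_exceptional : exceptional_sequence E) :
  quiver_connected (hom_ext_quiver E).
Proof.
have [E_exc E_seq] := E_exceptional.
have fgE s : finitely_generated (E s) by have [] := E_exc s.
pose pr s := presentation_exists H_hereditary (fgE s).
pose P1 s := projT1 (pr s); pose P0 s := projT1 (projT2 (pr s)).
pose i s : {linear P1 s -> P0 s} := projT1 (projT2 (projT2 (pr s))).
pose p s : {linear P0 s -> E s} := sval (projT2 (projT2 (projT2 (pr s)))).
have prP s : presentation (i s) (p s) /\ findim (P1 s) /\ findim (P0 s) :=
  svalP (projT2 (projT2 (projT2 (pr s)))).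
have pres s : presentation (i s) (p s) := proj1 (prP s).
have fin1 s : findim (P1 s) := proj1 (proj2 (prP s)).
have fin0 s : findim (P0 s) := proj2 (proj2 (prP s)).
have finE s : findim (E s) := fg_findim (fgE s).
have sesP s : ses (i s) (p s) by have [] := pres s.
have perpP s t : Hom_zero (E t) (E s) -> Ext1_zero (E t) (E s) -> perp (i t) (E s).
  move=> Hts Ets; split; first exact/(hom_vanish_zero (E s) (sesP t)).
  exact/(extensible_ext_vanish (E s) (pres t))/Ext1_zero_vanish.
have perpE (s t : 'I_n) : (s < t)%N -> perp (i t) (E s).
  by move=> /E_seq[]; exact: perpP.
have extE s : extensible (i s) (E s).
  have [_ _ Ess] := E_exc s.
  exact/(extensible_ext_vanish (E s) (pres s))/Ext1_zero_vanish.
have homE s : ~ hom_vanish (i s) (E s).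
  move=> /(hom_vanish_zero (E s) (sesP s)) Hss; have [_ [E_nz _] _] := E_exc s.
  by apply: E_nz; exact: (Hss idfun).
(* [L] is the connected component of [x]. *)
move=> x y; pose L := clos_refl_sym_trans _ (hom_ext_quiver E) x.
have [s t Ls nLt| |] := @connected_blocks k H H_hereditary n H_simples E P1 P0 i p
  pres fin1 fin0 finE perpE extE homE L _ H_connected.
(* An arrow either way would put [t] in the component; the absence of both gives the vanishing of
   Hom and Ext^1 in both directions. *)
- have no_arrow : ~ hom_ext_quiver E s t /\ ~ hom_ext_quiver E t s.
    split=> a; apply: nLt; apply: rst_trans Ls _; first exact: rst_step.
    by apply: rst_sym; exact: rst_step.
  have [/not_orP[/contrapT Hst /contrapT Ets] /not_orP[/contrapT Hts /contrapT Est]] :=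
    no_arrow.
  by split; apply: perpP.
- by move/(_ y).
- by move/(_ x); case; exact: rst_refl.
Qed.
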